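(* Let $p$ be a prime and let $G$ be a cyclic group of order $p$. For an integer $n\ge 0$, let $\hat b_n$ be the number of isomorphism classes of $\mathbb{Z}_pG$-modules of rank $1$ and order $p^n$, and let $\hat c_n$ be the number of those isomorphism classes whose members are in addition cohomologically trivial over $G$. Then $$\hat b_n=\begin{cases}1+p(n-1) & \text{if } n\ge 2,\\ 1 & \text{if } n=0,1,\end{cases}\qquad \hat c_n=\begin{cases}(p-1)(n-1) & \text{if } n\ge 2,\\ 0 & \text{if } n=1,\\ 1&\text{if } n=0,\end{cases}$$ and consequently $$\lim_{n\to\infty}\frac{\hat c_n}{\hat b_n}=1-p^{-1}.$$
   Context: $\mathbb{Z}_p$ is the ring of $p$-adic integers. A $\mathbb{Z}_pG$-module ''of rank $1$'' means a cyclic $\mathbb{Z}_pG$-module, i.e. one isomorphic to a quotient of $\mathbb{Z}_pG$ (the zero module is allowed, and is the one counted for $n=0$). A module $A$ is cohomologically trivial over $G$ if the Tate cohomology groups $\hat H^n(H,A)$ vanish for all $n\in\mathbb{Z}$ and all subgroups $H\le G$. *)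

(* Defs.v *)
From HB Require Import structures.
From mathcomp Require Import all_boot all_order all_fingroup all_algebra.
From mathcomp Require Import boolp classical_sets cardinality.

Set Implicit Arguments.
Unset Strict Implicit.
Unset Printing Implicit Defensive.

Import GRing.Theory.
Local Open Scope ring_scope.

(* The ring Z_p of p-adic integers, as the inverse limit of the rings Z/p^n    *)
(* for n >= 1. The library type 'Z_m is Z/m for m > 1 only, so padic p is      *)
(* meaningful for p > 1.                                                       *)
Section PadicIntegers.
Variable p : nat.

Definition padic_compat (x : forall n, 'Z_(p ^ n.+1)) : Prop :=
  forall n, x n = (x n.+1 : nat)%:R.

Record padic := Padic {
  padic_seq :> forall n, 'Z_(p ^ n.+1);
  _ : `[< padic_compat padic_seq >]
}.

HB.instance Definition _ := [isSub for padic_seq].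
HB.instance Definition _ := [Choice of padic by <:].

Lemma padicP (x : padic) : padic_compat x.
Proof. by case: x => x /= /asboolP. Qed.

Lemma padic_eqP (x y : padic) : (forall n, x n = y n) -> x = y.
Proof. by move=> xy; apply/val_inj/functional_extensionality_dep. Qed.

Lemma Zp_trunc_dvd n :
  ((Zp_trunc (p ^ n.+1)).+2 %| (Zp_trunc (p ^ n.+2)).+2)%N.
Proof.
case: p => [|[|q]]; first by rewrite !exp0n.
  by rewrite !exp1n.
have lt1 m : (1 < q.+2 ^ m.+1)%N by rewrite -[1%N](expn0 q.+2) ltn_exp2l.
by rewrite !Zp_cast // dvdn_exp2l.
Qed.

Lemma padic_mod n (k : nat) :
  (k %% (Zp_trunc (p ^ n.+2)).+2)%:R = k%:R :> 'Z_(p ^ n.+1).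
Proof.
by rewrite !Zp_nat; apply: val_inj; rewrite /= modn_dvdm // Zp_trunc_dvd.
Qed.

Lemma padic_add_subproof (x y : padic) : `[< padic_compat (fun n => x n + y n) >].
Proof. by apply/asboolP => n; rewrite padic_mod natrD -!padicP. Qed.

Lemma padic_mul_subproof (x y : padic) : `[< padic_compat (fun n => x n * y n) >].
Proof. by apply/asboolP => n; rewrite padic_mod natrM -!padicP. Qed.

Lemma padic_opp_subproof (x : padic) : `[< padic_compat (fun n => - x n) >].
Proof.
apply/asboolP => n; apply: (addrI (x n)); rewrite subrr [X in X + _]padicP.
by rewrite -natrD -padic_mod -[X in X%:R]/(val (x n.+1 - x n.+1)) subrr.
Qed.

Lemma padic_zero_subproof : `[< padic_compat (fun _ => 0) >].
Proof. by apply/asboolP. Qed.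

Lemma padic_one_subproof : `[< padic_compat (fun _ => 1) >].
Proof. by apply/asboolP => n; rewrite padic_mod. Qed.

Definition padic_zero := Padic padic_zero_subproof.
Definition padic_one := Padic padic_one_subproof.
Definition padic_opp x := Padic (padic_opp_subproof x).
Definition padic_add x y := Padic (padic_add_subproof x y).
Definition padic_mul x y := Padic (padic_mul_subproof x y).

Lemma padic_addA : associative padic_add.
Proof. by move=> x y z; apply: padic_eqP => n; apply: addrA. Qed.
Lemma padic_addC : commutative padic_add.
Proof. by move=> x y; apply: padic_eqP => n; apply: addrC. Qed.
Lemma padic_add0 : left_id padic_zero padic_add.
Proof. by move=> x; apply: padic_eqP => n; apply: add0r. Qed.
Lemma padic_addN : left_inverse padic_zero padic_opp padic_add.
Proof. by move=> x; apply: padic_eqP => n; apply: addNr. Qed.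

HB.instance Definition _ :=
  GRing.isZmodule.Build padic padic_addA padic_addC padic_add0 padic_addN.

Lemma padic_mulA : associative padic_mul.
Proof. by move=> x y z; apply: padic_eqP => n; apply: mulrA. Qed.
Lemma padic_mulC : commutative padic_mul.
Proof. by move=> x y; apply: padic_eqP => n; apply: mulrC. Qed.
Lemma padic_mul1 : left_id padic_one padic_mul.
Proof. by move=> x; apply: padic_eqP => n; apply: mul1r. Qed.
Lemma padic_mulDl : left_distributive padic_mul (@GRing.add padic).
Proof. by move=> x y z; apply: padic_eqP => n; apply: mulrDl. Qed.
Lemma padic_one_neq0 : padic_one != 0.
Proof. by apply/eqP => /(congr1 (fun x : padic => x 0)). Qed.

HB.instance Definition _ :=
  GRing.Zmodule_isComNzRing.Build padic
    padic_mulA padic_mulC padic_mul1 padic_mulDl padic_one_neq0.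

End PadicIntegers.

(* The group ring R[gT] of a finite group: a function a : gT -> R stands for   *)
(* the formal sum of the a(g) g, and multiplication is convolution. The alias  *)
(* keeps it apart from {ffun gT -> R}.                                         *)
Definition group_ring (R : nzRingType) (gT : finGroupType) : Type :=
  {ffun gT -> R}.

Section GroupRing.
Variables (R : nzRingType) (gT : finGroupType).
Local Notation RG := (group_ring R gT).

HB.instance Definition _ := GRing.Zmodule.copy RG {ffun gT -> R}.

Definition gring_elt (g : gT) : RG := [ffun h => (h == g)%:R].

Definition gring_mul (a b : RG) : RG :=
  [ffun g => \sum_h a h * b (h^-1 * g)%g].

Lemma gring_mulA : associative gring_mul.
Proof.
move=> a b c; apply/ffunP => g; rewrite !ffunE.
under eq_bigr do rewrite ffunE big_distrr /=.
under [RHS]eq_bigr do rewrite ffunE big_distrl /=.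
rewrite [RHS]exchange_big /=; apply: eq_bigr => h _.
rewrite [RHS](reindex_inj (mulgI h)) /=; apply: eq_bigr => k _.
by rewrite mulrA mulKg invMg mulgA.
Qed.

Lemma gring_mul1l : left_id (gring_elt 1%g) gring_mul.
Proof.
move=> a; apply/ffunP => g; rewrite ffunE (bigD1 1%g) //= big1 => [|h /negPf h1].
  by rewrite ffunE eqxx mul1r addr0 invg1 mul1g.
by rewrite ffunE h1 mul0r.
Qed.

Lemma gring_mul1r : right_id (gring_elt 1%g) gring_mul.
Proof.
move=> a; apply/ffunP => g; rewrite ffunE (bigD1 g) //= big1 => [|h /negPf hg].
  by rewrite ffunE mulVg eqxx mulr1 addr0.
by rewrite ffunE -eq_mulVg1 hg mulr0.
Qed.

Lemma gring_mulDl : left_distributive gring_mul (@GRing.add RG).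
Proof.
move=> a b c; apply/ffunP => g; rewrite !ffunE -big_split /=.
by apply: eq_bigr => h _; rewrite ffunE mulrDl.
Qed.

Lemma gring_mulDr : right_distributive gring_mul (@GRing.add RG).
Proof.
move=> a b c; apply/ffunP => g; rewrite !ffunE -big_split /=.
by apply: eq_bigr => h _; rewrite ffunE mulrDr.
Qed.

Lemma gring_one_neq0 : gring_elt 1%g != 0.
Proof.
by apply/eqP => /ffunP/(_ 1%g)/eqP; rewrite !ffunE eqxx oner_eq0.
Qed.

HB.instance Definition _ :=
  GRing.Zmodule_isNzRing.Build RG
    gring_mulA gring_mul1l gring_mul1r gring_mulDl gring_mulDr gring_one_neq0.

End GroupRing.

Section Modules.
Variable R : nzRingType.

Definition cyclic_module (M : lmodType R) : Prop :=
  exists v : M, forall m : M, exists a : R, m = a *: v.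

Definition module_iso (M N : lmodType R) : Prop :=
  exists f : {linear M -> N}, bijective f.

Lemma module_iso_sym M N : module_iso M N -> module_iso N M.
Proof.
case=> f [g fK gK]; have g_lin : linear g.
  by move=> a x y; apply: (can_inj fK); rewrite linearP !gK.
pose gL := GRing.isLinear.Build R N M *:%R g g_lin.
pose g' : {linear N -> M} := HB.pack g gL.
by exists g'; exists f.
Qed.

Lemma module_iso_trans M N Q : module_iso M N -> module_iso N Q -> module_iso M Q.
Proof. by case=> f f_bij [g g_bij]; exists (g \o f); apply: bij_comp. Qed.

(* There are exactly k isomorphism classes of modules satisfying P, expressed  *)
(* by a complete irredundant list of representatives: for universe reasons,    *)
(* the classes cannot be collected in a set (lmodType R).                      *)
Definition nb_iso_classes (P : lmodType R -> Prop) (k : nat) : Prop :=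
  exists M : 'I_k -> lmodType R,
    [/\ forall i, P (M i),
        forall i j, module_iso (M i) (M j) -> i = j
      & forall N, P N -> exists i, module_iso N (M i)].

Lemma nb_iso_classes_uniq P k l :
  nb_iso_classes P k -> nb_iso_classes P l -> k = l.
Proof.
have le_nb k' l' : nb_iso_classes P k' -> nb_iso_classes P l' -> (k' <= l')%N.
  move=> [M [MP Minj _]] [N [_ _ Nsurj]].
  have /choice[f fP] i := Nsurj _ (MP i).
  rewrite -[k']card_ord -[l']card_ord; apply: (@leq_card _ _ f) => i j fij.
  apply: Minj; apply: module_iso_trans (fP i) _.
  by rewrite fij; apply: module_iso_sym.
by move=> Pk Pl; apply/eqP; rewrite eqn_leq !le_nb.
Qed.

End Modules.

(* Tate cohomology of H with coefficients in A, computed by the complete       *)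
(* standard resolution: for m >= 0 both C^m and C^(-1-m) consist of the        *)
(* H-equivariant functions H^(m+1) -> A, with differentials                    *)
(*   C^m -> C^(m+1)        (d f)(s_0,..,s_(m+1)) =                             *)
(*                           sum_i (-1)^i f(.., s_(i-1), s_(i+1), ..)          *)
(*   C^(-1) -> C^0         (d f)(s_0) = sum_(t in H) f(t)                      *)
(*   C^(-2-m) -> C^(-1-m)  (d f)(s_0,..,s_m) =                                 *)
(*                  sum_(t in H) sum_i (-1)^i f(.., s_(i-1), t, s_i, ..)       *)
(* Recall that Negz m is the integer - (m + 1).                                *)
Section TateCohomology.
Variables (R : nzRingType) (gT : finGroupType) (H : {group gT}).
Variable A : lmodType (group_ring R gT).

Local Notation tuples m := {ffun 'I_m.+1 -> subg_of H}.

Definition cochain (m : nat) : Type := {ffun tuples m -> A}.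

Definition equivariant m (f : cochain m) : Prop :=
  forall (h : subg_of H) (s : tuples m),
    f [ffun j => (h * s j)%g] = gring_elt R (sgval h) *: f s.

Definition d_pos m (f : cochain m) : cochain m.+1 :=
  [ffun s : tuples m.+1 => \sum_(i < m.+2) (-1) ^+ i *: f [ffun j => s (lift i j)]].

Definition d_mid (f : cochain 0) : cochain 0 :=
  [ffun=> \sum_(t : subg_of H) f [ffun=> t]].

Definition d_neg m (f : cochain m.+1) : cochain m :=
  [ffun s : tuples m => \sum_(t : subg_of H) \sum_(i < m.+2)
    (-1) ^+ i *: f [ffun j => oapp s t (unlift i j)]].

Definition tate_index (n : int) : nat :=
  match n with Posz m => m | Negz m => m end.

Definition tate_cocycles (n : int) : set (cochain (tate_index n)) :=
  match n with
  | Posz m => [set f | equivariant f /\ d_pos f = [ffun=> 0]]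
  | Negz 0 => [set f | equivariant f /\ d_mid f = [ffun=> 0]]
  | Negz m.+1 => [set f | equivariant f /\ d_neg f = [ffun=> 0]]
  end%classic.

Definition tate_coboundaries (n : int) : set (cochain (tate_index n)) :=
  match n with
  | Posz 0 => [set d_mid f | f in @equivariant 0]
  | Posz m.+1 => [set d_pos f | f in @equivariant m]
  | Negz m => [set d_neg f | f in @equivariant m.+1]
  end%classic.

Definition tate_vanishes (n : int) : Prop :=
  (@tate_cocycles n `<=` @tate_coboundaries n)%classic.

End TateCohomology.

Definition cohomologically_trivial (R : nzRingType) (gT : finGroupType)
    (A : lmodType (group_ring R gT)) : Prop :=
  forall (H : {group gT}) (n : int), tate_vanishes H A n.

Section Counting.
Variables (p : nat) (gT : finGroupType).

(* Z_p gT-modules of rank 1 and order p ^ n. *)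
Definition rank1_of_order (n : nat) (M : lmodType (group_ring (padic p) gT)) :
    Prop :=
  cyclic_module M /\ ([set: M]%classic #= `I_(p ^ n)%classic)%card.

Definition ct_rank1_of_order (n : nat)
    (M : lmodType (group_ring (padic p) gT)) : Prop :=
  rank1_of_order n M /\ cohomologically_trivial M.

End Counting.

(* Main.v *)
Require Import Defs.
From HB Require Import structures.
From mathcomp Require Import all_boot all_order all_fingroup all_algebra all_solvable.
From mathcomp Require Import all_classical all_reals all_analysis.
From mathcomp Require Import ring.

Set Implicit Arguments.
Unset Strict Implicit.
Unset Printing Implicit Defensive.

Import Order.TTheory GRing.Theory Num.Theory numFieldNormedType.Exports.
Local Open Scope classical_set_scope.
Local Open Scope ring_scope.

(** Let L = Z_p[G], let s generate G, D = s - 1, and let N be the sum of the elements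
of G. As L is commutative, isomorphism classes of cyclic modules correspond to ideals,
through the annihilator of a generator (nb_iso_ideals), so the ideals of index p^n have
to be counted, together with those whose quotient is cohomologically trivial.

The ring L is local with maximal ideal (D, N) and residue field of order p; N L is a copy
of Z_p, in which N N = p N, and L / N L is a discrete valuation ring with uniformizer D.
An ideal I of finite index therefore has two invariants: the least i with p^i N in I, and
the least j with D^j in I + N L. Its index is p^(i+j) (has_index_invariants). For j > 0 it
is generated by D^j + c p^(i-1) N and p^i N for a unique c < p, with c = 0 if i = 0
(ideal_classification, std_ideal_invariants, std_ideal_inj). For n > 0 this gives
p (n - 1) ideals with 0 < i < n and one ideal with i = 0; for n = 0 only L itself.

If i > 0 and c > 0, the ideal is generated by the regular element
y = D^j + c p^(i-1) N, because N y = c p^i N (std_ideal_principal). The quotient L / L y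
is then cohomologically trivial (cyclic_ct): the Tate cohomology of L vanishes for every
subgroup, and cocycles of L / L y lift along 0 -> L -> L -> L / L y -> 0
(exact_quotient). The vanishing for L is obtained from contracting homotopies of the
complex of all functions, which an average over the subgroup makes equivariant
(relatively_projective_exact). If c = 0, the class of D^(j-1) in L / I is invariant under
G but is not a norm, so the Tate group of degree 0 is not zero (std_ideal0_not_ct). There
remain (p - 1) (n - 1) ideals. *)

(** * Tate cohomology of quotients of the group ring by a regular element *)

Section Cochains.
Variables (R : nzRingType) (gT : finGroupType) (H : {group gT}).
Local Notation RG := (group_ring R gT).
Local Notation tuples m := {ffun 'I_m.+1 -> subg_of H}.
Local Notation C A m := {ffun tuples m -> A}.

Definition act (A : lmodType RG) (h : subg_of H) : A -> A :=
  *:%R (gring_elt R (sgval h)).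

Lemma actM (A : lmodType RG) (h k : subg_of H) (a : A) :
  act h (act k a) = act (h * k)%g a.
Proof.
rewrite /act scalerA; congr (_ *: _); apply/ffunP => g.
rewrite ffunE (bigD1 (sgval h)) //= big1 ?addr0 => [|l /negPf hl].
  by rewrite !ffunE eqxx mul1r -(inj_eq (mulgI (sgval h))) mulKVg.
by rewrite ffunE hl mul0r.
Qed.

Lemma act1 (A : lmodType RG) (a : A) : act (1%g : subg_of H) a = a.
Proof. exact: scale1r. Qed.

Definition shift m (h : subg_of H) (s : tuples m) : tuples m :=
  [ffun j => (h * s j)%g].

(** Cochains carry two operations: translation of the arguments by an element
of H (pull), and composition with a map of coefficients (push). Equivariance says
that the two agree. *)
Definition pull (A : Type) m (h : subg_of H) (f : C A m) : C A m :=
  [ffun s => f (shift h s)].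

Definition push (A B : Type) (u : A -> B) m (f : C A m) : C B m :=
  [ffun s => u (f s)].

Lemma equivariantP (A : lmodType RG) m (f : C A m) :
  equivariant f <-> forall h, pull h f = push (@act A h) f.
Proof.
split=> [ef h|ef h s]; first by apply/ffunP => s; rewrite !ffunE; apply: ef.
by have /ffunP/(_ s) := ef h; rewrite !ffunE.
Qed.

(** The three differentials of the complete resolution are instances of one
notion: operations on all functions on H^(m+1), equivariant or not, which are
additive, functorial for additive maps of coefficients (in particular for maps that
are not H-linear, such as the trace components below), and which commute with
translation. *)
Record natural_op m m' (d : forall A : lmodType RG, C A m -> C A m') : Prop :=
  NaturalOp {
    opD : forall A : lmodType RG, {morph @d A : f g / f + g};
    op_push : forall (A B : lmodType RG) (u : {additive A -> B}) (f : C A m),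
      d B (push u f) = push u (d A f);
    op_pull : forall (A : lmodType RG) h (f : C A m),
      d A (pull h f) = pull h (d A f)
  }.

Lemma natural_comp m m' m'' d d' :
  @natural_op m m' d -> @natural_op m' m'' d' ->
  natural_op (fun A f => d' A (d A f)).
Proof.
move=> [dD dpush dpull] [dD' dpush' dpull']; split=> [A f g|A B u f|A h f].
- by rewrite /= dD dD'.
- by rewrite /= dpush dpush'.
- by rewrite /= dpull dpull'.
Qed.

Section Naturality.
Variables (m m' : nat) (d : forall A : lmodType RG, C A m -> C A m').
Hypothesis dN : natural_op d.

Lemma op0 (A : lmodType RG) : @d A 0 = 0.
Proof. by apply: (addrI (d 0)); rewrite -(opD dN) !addr0. Qed.

Lemma opB (A : lmodType RG) (f g : C A m) : d (f - g) = d f - d g.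
Proof. by apply: (addIr (d g)); rewrite -(opD dN) !subrK. Qed.

Lemma op_sum (A : lmodType RG) (F : subg_of H -> C A m) :
  d (\sum_h F h) = \sum_h d (F h).
Proof. by elim/big_rec2: _ => [|h f g _ <-]; rewrite ?op0 // (opD dN). Qed.

(** Equivariance of f equates a translate of f with a push of f by the action,
and a natural operation commutes with both. *)
Lemma op_equivariant (A : lmodType RG) (f : C A m) :
  equivariant f -> equivariant (d f).
Proof.
move=> /equivariantP ef; apply/equivariantP => h.
by rewrite -(op_pull dN) ef -(op_push dN).
Qed.

End Naturality.

Lemma signZ_push (A B : lmodType RG) (u : {additive A -> B}) n (a : A) :
  u ((-1) ^+ n *: a) = (-1) ^+ n *: u a.
Proof. by rewrite -signr_odd; case: odd; rewrite ?scaleN1r ?raddfN ?scale1r. Qed.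

Lemma d_pos_natural m : @natural_op m m.+1 (fun A => @d_pos _ _ H A m).
Proof.
split=> [A f g|A B u f|A h f]; apply/ffunP => s; rewrite !ffunE.
- by rewrite -big_split; apply: eq_bigr => i _; rewrite ffunE scalerDr.
- by rewrite raddf_sum; apply: eq_bigr => i _; rewrite ffunE signZ_push.
- apply: eq_bigr => i _; rewrite ffunE; congr (_ *: f _).
  by apply/ffunP => j; rewrite !ffunE.
Qed.

Lemma d_mid_natural : @natural_op 0 0 (fun A => @d_mid _ _ H A).
Proof.
split=> [A f g|A B u f|A h f]; apply/ffunP => s; rewrite !ffunE.
- by rewrite -big_split; apply: eq_bigr => i _; rewrite ffunE.
- by rewrite raddf_sum; apply: eq_bigr => i _; rewrite ffunE.
- rewrite [RHS](reindex_inj (mulgI h)) /=; apply: eq_bigr => t _.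
  by rewrite ffunE; congr (f _); apply/ffunP => j; rewrite !ffunE.
Qed.

Lemma d_neg_natural m : @natural_op m.+1 m (fun A => @d_neg _ _ H A m).
Proof.
split=> [A f g|A B u f|A h f]; apply/ffunP => s; rewrite !ffunE.
- rewrite -big_split; apply: eq_bigr => t _; rewrite -big_split.
  by apply: eq_bigr => i _; rewrite ffunE scalerDr.
- rewrite raddf_sum; apply: eq_bigr => t _; rewrite raddf_sum.
  by apply: eq_bigr => i _; rewrite ffunE signZ_push.
- rewrite [RHS](reindex_inj (mulgI h)) /=; apply: eq_bigr => t _.
  apply: eq_bigr => i _; rewrite ffunE; congr (_ *: f _).
  by apply/ffunP => j; rewrite !ffunE; case: unliftP => //= k _; rewrite ffunE.
Qed.

Definition cons_tuple m (h : subg_of H) (s : tuples m) : tuples m.+1 :=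
  [ffun j => oapp s h (unlift ord0 j)].
Definition tail_tuple m (s : tuples m.+1) : tuples m :=
  [ffun j => s (lift ord0 j)].

Lemma cons_tupleS m h (s : tuples m) i : cons_tuple h s (lift ord0 i) = s i.
Proof. by rewrite ffunE liftK. Qed.

Lemma lift0_lift n (i : 'I_n.+1) (j : 'I_n) :
  lift (lift ord0 i) (lift ord0 j) = lift ord0 (lift i j).
Proof. by apply: val_inj; rewrite /= /bump /= !add1n ltnS addnS. Qed.

Section Homotopies.
Variable A : lmodType RG.

(** On all functions, not only the equivariant ones, the complete resolution is
contractible: h_pos inserts 1 in front of the arguments, while h_mid and h_neg
extend by zero from the tuples that start with 1. They are not equivariant; the
trace argument repairs this. *)
Definition h_pos m (f : C A m.+1) : C A m :=
  [ffun s : tuples _ => f (cons_tuple 1%g s)].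
Definition h_mid (f : C A 0) : C A 0 :=
  [ffun s : tuples _ => if s ord0 == 1%g then f s else 0].
Definition h_neg m (f : C A m) : C A m.+1 :=
  [ffun s : tuples _ => if s ord0 == 1%g then f (tail_tuple s) else 0].

Lemma h_pos_homotopy m (f : C A m.+1) :
  h_pos (d_pos f) = f - d_pos (h_pos f).
Proof.
apply/ffunP => s; rewrite !ffunE big_ord_recl expr0 scale1r; congr (_ + _).
  by congr (f _); apply/ffunP => j; rewrite ffunE cons_tupleS.
rewrite -sumrN; apply: eq_bigr => i _; rewrite /= exprS mulN1r scaleNr !ffunE.
congr (- (_ *: f _)); apply/ffunP => j; rewrite !ffunE.
case: (unliftP ord0 j) => [k|] -> /=.
  by rewrite lift0_lift liftK /= ffunE.
have -> : lift (lift ord0 i) ord0 = ord0 by apply: val_inj.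
by rewrite unlift_none.
Qed.

Lemma h_pos_homotopy0 (f : C A 0) :
  h_pos (d_pos f) = f - [ffun=> f [ffun=> 1%g]].
Proof.
apply/ffunP => s; rewrite !ffunE !big_ord_recl big_ord0 addr0 scale1r /=.
rewrite /bump /= expr1 scaleN1r; congr (f _ - f _).
  by apply/ffunP => j; rewrite !ffunE liftK.
apply/ffunP => j; rewrite !ffunE (ord1 j).
have -> : lift (lift ord0 ord0) ord0 = ord0 :> 'I_2 by apply: val_inj.
by rewrite unlift_none.
Qed.

Lemma h_mid_homotopy (f : C A 0) : d_mid (h_mid f) = [ffun=> f [ffun=> 1%g]].
Proof.
apply/ffunP => s; rewrite !ffunE (bigD1 1%g) //= big1 => [|t /negPf t1].
  by rewrite !ffunE eqxx addr0.
by rewrite !ffunE t1.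
Qed.

(** In the sum defining d_neg, inserting t in front of s meets the support of
h_neg only for t = 1 and gives back f s; inserting t further leaves the head of s
in place, so these terms see the support condition on s itself. *)
Lemma d_neg_h_neg_at m (f : C A m) (s : tuples m) :
  d_neg (h_neg f) s = f s - (if s ord0 == 1%g then
    \sum_(t : subg_of H) \sum_(i < m.+1)
      (-1) ^+ i *: f [ffun j => oapp s t (unlift (lift ord0 i) (lift ord0 j))]
    else 0).
Proof.
rewrite ffunE exchange_big big_ord_recl expr0 /=; congr (_ + _).
  rewrite (bigD1 1%g) //= big1 => [|t /negPf t1].
    rewrite !ffunE unlift_none /= eqxx addr0 scale1r; congr (f _).
    by apply/ffunP => j; rewrite !ffunE liftK.
  by rewrite !ffunE unlift_none /= t1 scaler0.
rewrite (eq_bigr (fun i : 'I_m.+1 => \sum_(t : subg_of H)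
  if s ord0 == 1%g then - ((-1) ^+ i *: f [ffun j => oapp s t
     (unlift (lift ord0 i) (lift ord0 j))]) else 0)) => [|i _].
  case: ifP => _; last by rewrite big1 ?subr0 ?oppr0 // => i _; rewrite big1.
  by rewrite exchange_big -sumrN; apply: eq_bigr => t _; rewrite sumrN.
apply: eq_bigr => t _; rewrite exprS mulN1r !ffunE.
have -> : unlift (lift ord0 i) ord0 = Some (ord0 : 'I_m.+1).
  rewrite (_ : ord0 = lift (lift ord0 i) ord0 :> 'I_m.+2) ?liftK //.
  exact: val_inj.
rewrite /=; case: ifP => _; rewrite ?scaler0 // scaleNr.
by congr (- (_ *: f _)); apply/ffunP => j; rewrite !ffunE.
Qed.

Lemma h_neg_homotopy m (f : C A m.+1) :
  d_neg (h_neg f) = f - h_neg (d_neg f).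
Proof.
apply/ffunP => s; rewrite d_neg_h_neg_at !ffunE; congr (_ - _).
case: ifP => // _; apply: eq_bigr => t _; apply: eq_bigr => i _.
congr (_ *: f _); apply/ffunP => j; rewrite !ffunE.
case: (unliftP i j) => [k|] -> /=; last by rewrite unlift_none.
by rewrite -lift0_lift liftK /= ffunE.
Qed.

Lemma h_neg_homotopy0 (f : C A 0) :
  d_neg (h_neg f) = f - h_mid (d_mid f).
Proof.
apply/ffunP => s; rewrite d_neg_h_neg_at !ffunE; congr (_ - _).
case: ifP => // _; apply: eq_bigr => t _; rewrite big_ord1 scale1r; congr (f _).
by apply/ffunP => j; rewrite !ffunE (ord1 j) unlift_none.
Qed.

Lemma h_mid0 : h_mid 0 = 0.
Proof. by apply/ffunP => s; rewrite !ffunE if_same. Qed.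

Lemma h_neg0 m : h_neg (0 : C A m) = 0.
Proof. by apply/ffunP => s; rewrite !ffunE if_same. Qed.

Lemma h_pos0 m : h_pos (0 : C A m.+1) = 0.
Proof. by apply/ffunP => s; rewrite !ffunE. Qed.

End Homotopies.

(** A translate of any tuple starts with 1, so a natural operation vanishes
once its values at such tuples vanish. *)
Lemma op_eq0_of_h_pos m m' d : @natural_op m m'.+1 d ->
  forall A : lmodType RG, (forall f : C A m, h_pos (d A f) = 0) ->
  forall f : C A m, d A f = 0.
Proof.
move=> dN A hd0 f; apply/ffunP => s; rewrite [RHS]ffunE.
have /ffunP/(_ (shift (s ord0)^-1%g (tail_tuple s))) := hd0 (pull (s ord0) f).
rewrite (op_pull dN) !ffunE => <-; congr (d A f _); apply/ffunP => j.
rewrite !ffunE; case: (unliftP ord0 j) => [k|] -> /=; last by rewrite mulg1.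
by rewrite !ffunE mulKVg.
Qed.

(** Every function is a sum of translates of functions supported on the tuples
that start with 1, and the latter are in the image of h_neg. *)
Lemma op_eq0_of_h_neg m m' d : @natural_op m.+1 m' d ->
  forall A : lmodType RG, (forall f : C A m, d A (h_neg f) = 0) ->
  forall f : C A m.+1, d A f = 0.
Proof.
move=> dN A dh0 f.
have -> : f = \sum_h pull h^-1 (h_neg (h_pos (pull h f))).
  apply/ffunP => s; rewrite sum_ffunE (bigD1 (s ord0)) //= big1.
    rewrite !ffunE mulVg eqxx addr0; congr (f _); apply/ffunP => j.
    rewrite !ffunE; case: (unliftP ord0 j) => [k|] -> /=; last by rewrite mulg1.
    by rewrite !ffunE mulKVg.
  by move=> h /negPf hs; rewrite !ffunE -eq_mulVg1 hs.
rewrite (op_sum dN) big1 // => h _; rewrite (op_pull dN) dh0.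
by apply/ffunP => s; rewrite !ffunE.
Qed.

Lemma d_pos_d_mid (A : lmodType RG) (f : C A 0) : d_pos (d_mid f) = 0.
Proof.
apply/ffunP => s; rewrite !ffunE !big_ord_recl big_ord0 !ffunE.
by rewrite expr0 scale1r expr1 scaleN1r addr0 subrr.
Qed.

(** The homotopy identity h d = 1 - d h gives h d d = d d h, so d d = 0 follows
by induction from the degree below, without any computation with faces; the
induction starts from d_pos (d_mid f) = 0, which holds because d_mid f is constant. *)
Lemma d_pos_d_pos (A : lmodType RG) m (f : C A m) : d_pos (d_pos f) = 0.
Proof.
elim: m f => [|m IHm] f; move: f; apply: (op_eq0_of_h_pos
  (natural_comp (d_pos_natural _) (d_pos_natural _))) => f /=;
  rewrite h_pos_homotopy.
  by rewrite h_pos_homotopy0 (opB (d_pos_natural 0)) -h_mid_homotopy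
             d_pos_d_mid subr0 subrr.
by rewrite h_pos_homotopy (opB (d_pos_natural _)) IHm subr0 subrr.
Qed.

Lemma d_mid_d_neg (A : lmodType RG) (f : C A 1) : d_mid (d_neg f) = 0.
Proof.
move: f; apply: (op_eq0_of_h_neg
  (natural_comp (d_neg_natural _) d_mid_natural)) => f /=.
rewrite h_neg_homotopy0 (opB d_mid_natural) h_mid_homotopy.
by apply/ffunP => s; rewrite !ffunE subrr.
Qed.

(** Same induction as for nonnegative degrees, run towards negative degrees:
d d h = h d d. *)
Lemma d_neg_d_neg (A : lmodType RG) m (f : C A m.+2) : d_neg (d_neg f) = 0.
Proof.
elim: m f => [|m IHm] f; move: f; apply: (op_eq0_of_h_neg
  (natural_comp (d_neg_natural _) (d_neg_natural _))) => f /=;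
  rewrite h_neg_homotopy (opB (d_neg_natural _)).
  by rewrite h_neg_homotopy0 d_mid_d_neg h_mid0 subr0 subrr.
by rewrite h_neg_homotopy IHm h_neg0 subr0 subrr.
Qed.

Definition exact_at (A : lmodType RG) m0 m1 m2
    (d0 : C A m0 -> C A m1) (d1 : C A m1 -> C A m2) :=
  forall f, equivariant f -> d1 f = 0 -> exists2 g, equivariant g & f = d0 g.

(** The identity is the trace over H of an additive endomorphism e. *)
Definition relatively_projective (A : lmodType RG) :=
  exists e : {additive A -> A},
    forall a, \sum_h act h (e (act h^-1%g a)) = a.

(** If f is an equivariant cocycle and f = d g for a possibly
non-equivariant g, then applying e and averaging over H turns g into an equivariant
cochain, and f into the trace of e, that is f itself. *)
Lemma relatively_projective_exact (A : lmodType RG) m0 m1 m2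
    (d0 : forall A : lmodType RG, C A m0 -> C A m1)
    (d1 : C A m1 -> C A m2) :
  natural_op d0 -> relatively_projective A ->
  (forall f, d1 f = 0 -> exists g, f = d0 A g) -> exact_at (@d0 A) d1.
Proof.
move=> dN [e eP] ex f /equivariantP ef /ex [g fg].
exists (\sum_h push (@act A h) (push e (pull h^-1%g g))).
  move=> k s; rewrite !sum_ffunE scaler_sumr [LHS](reindex_inj (mulgI k)) /=.
  apply: eq_bigr => h _; rewrite !ffunE -actM; congr (act k (act h (e (g _)))).
  by apply/ffunP => j; rewrite !ffunE invMg -mulgA mulKg.
rewrite (op_sum dN); apply/ffunP => s; rewrite sum_ffunE -[LHS]eP.
apply: eq_bigr => h _; rewrite !(op_push dN) (op_pull dN) -fg ef !ffunE.
by [].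
Qed.

(** This is the long exact sequence of 0 -> L -> L -> A -> 0 in the only case
needed. A cocycle f of A lifts to an equivariant cochain F of L, whose differential
is y K for a cocycle K because y is injective; K = d P, and F - y P is a cocycle,
hence a coboundary, which lifts f. *)
Lemma exact_quotient (L A : lmodType RG) (pi : {linear L -> A})
    (y : {linear L -> L}) m0 m1 m2 m3
    (d0 : forall A : lmodType RG, C A m0 -> C A m1)
    (d1 : forall A : lmodType RG, C A m1 -> C A m2)
    (d2 : forall A : lmodType RG, C A m2 -> C A m3) :
  natural_op d0 -> natural_op d1 -> natural_op d2 ->
  (forall f : C L m1, d2 L (d1 L f) = 0) ->
  exact_at (d0 L) (d1 L) -> exact_at (d1 L) (d2 L) ->
  injective y -> (forall a, exists b, a = pi b) ->
  (forall b, pi b = 0 <-> exists c, b = y c) ->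
  exact_at (d0 A) (d1 A).
Proof.
move=> d0N d1N d2N d21 ex1 ex2 y_inj /choice[lift pi_lift] kerpi f ef d1f.
(* Lifting only the value at tuples with head 1 and translating makes the lift
   equivariant. *)
pose F : C L m1 :=
  [ffun s : tuples m1 => act (s ord0) (lift (f (shift (s ord0)^-1%g s)))].
have eF : equivariant F.
  move=> h s; rewrite !ffunE -[RHS]/(act h (act (s ord0) _)) actM.
  congr (act _ (lift (f _))).
  by apply/ffunP => j; rewrite !ffunE invMg -mulgA mulKg.
have piF : push pi F = f.
  apply/ffunP => s; rewrite !ffunE linearZ /= -pi_lift.
  by have -> := ef (s ord0)^-1%g s; rewrite -[LHS]/(act _ (act _ _)) actM mulgV act1.
clearbody F.
have /choice[K0 d1F] s : exists c, d1 L F s = y c.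
  apply/kerpi; transitivity (push pi (d1 L F) s); first by rewrite ffunE.
  by rewrite -(op_push d1N) piF d1f ffunE.
pose K : C L m2 := [ffun s => K0 s].
have yK : push y K = d1 L F by apply/ffunP => s; rewrite !ffunE d1F.
have eK : equivariant K.
  move=> h s; apply: y_inj; rewrite !ffunE linearZ /= -!d1F.
  exact: (op_equivariant d1N eF).
have d2K : d2 L K = 0.
  apply/ffunP => s; apply: y_inj; rewrite ffunE raddf0.
  transitivity (push y (d2 L K) s); first by rewrite ffunE.
  by rewrite -(op_push d2N) yK d21 ffunE.
have [P eP KP] := ex2 _ eK d2K.
have [||g eg Fg] := ex1 (F - push y P).
- move=> h s; rewrite !ffunE scalerBr; congr (_ - _); first exact: eF.
  by rewrite eP linearZ.
- by rewrite (opB d1N) (op_push d1N) -KP yK subrr.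
exists (push pi g).
  by move=> h s; rewrite !ffunE eg linearZ.
rewrite (op_push d0N) -Fg -piF; apply/ffunP => s; rewrite !ffunE raddfB /=.
by rewrite (_ : pi (y _) = 0) ?subr0 //; apply/kerpi; exists (P s).
Qed.

Lemma tate_vanishes_quotient (L A : lmodType RG) (pi : {linear L -> A})
    (y : {linear L -> L}) :
  relatively_projective L -> injective y -> (forall a, exists b, a = pi b) ->
  (forall b, pi b = 0 <-> exists c, b = y c) ->
  forall n, tate_vanishes H A n.
Proof.
move=> rp y_inj pi_surj kerpi.
have xpos m : exact_at (@d_pos _ _ H L m) (@d_pos _ _ H L m.+1).
  apply: (relatively_projective_exact (d_pos_natural m)) => // f df.
  exists (h_pos f); apply/eqP; rewrite -subr_eq0 -h_pos_homotopy df.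
  by rewrite h_pos0.
have xmidpos : exact_at (@d_mid _ _ H L) (@d_pos _ _ H L 0).
  apply: (relatively_projective_exact d_mid_natural) => // f df.
  exists (h_mid f); apply/eqP; rewrite h_mid_homotopy -subr_eq0.
  by rewrite -h_pos_homotopy0 df h_pos0.
have xnegmid : exact_at (@d_neg _ _ H L 0) (@d_mid _ _ H L).
  apply: (relatively_projective_exact (d_neg_natural 0)) => // f df.
  by exists (h_neg f); rewrite h_neg_homotopy0 df h_mid0 subr0.
have xneg m : exact_at (@d_neg _ _ H L m.+1) (@d_neg _ _ H L m).
  apply: (relatively_projective_exact (d_neg_natural m.+1)) => // f df.
  by exists (h_neg f); rewrite h_neg_homotopy df h_neg0 subr0.
have [Npos Nneg] := (d_pos_natural, d_neg_natural).
case=> [[|m]|[|[|m]]] f /= [ef df].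
- have [g] := exact_quotient d_mid_natural (Npos 0) (Npos 1)
    (@d_pos_d_pos L 0) xmidpos (xpos 0) y_inj pi_surj kerpi ef df.
  by exists g.
- have [g] := exact_quotient (Npos m) (Npos m.+1) (Npos m.+2)
    (@d_pos_d_pos L m.+1) (xpos m) (xpos m.+1) y_inj pi_surj kerpi ef df.
  by exists g.
- have [g] := exact_quotient (Nneg 0) d_mid_natural (Npos 0)
    (@d_pos_d_mid L) xnegmid xmidpos y_inj pi_surj kerpi ef df.
  by exists g.
- have [g] := exact_quotient (Nneg 1) (Nneg 0) d_mid_natural
    (@d_mid_d_neg L) (xneg 0) xnegmid y_inj pi_surj kerpi ef df.
  by exists g.
- have [g] := exact_quotient (Nneg m.+2) (Nneg m.+1) (Nneg m)
    (@d_neg_d_neg L m) (xneg m.+1) (xneg m) y_inj pi_surj kerpi ef df.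
  by exists g.
Qed.

(** Take for e the restriction of functions on G to a transversal of
the right cosets of H. *)
Lemma group_ring_relatively_projective : relatively_projective (RG^o).
Proof.
pose e0 (a : RG^o) : RG^o := [ffun g => if g == repr (H :* g)%g then a g else 0].
have e0D : zmod_morphism e0.
  by move=> a b; apply/ffunP => g; rewrite !ffunE; case: ifP; rewrite ?subr0.
pose e0A := GRing.isZmodMorphism.Build RG^o RG^o e0 e0D.
pose e : {additive RG^o -> RG^o} := HB.pack e0 e0A.
have actE h (a : RG^o) g : act h a g = a ((sgval h)^-1 * g)%g.
  rewrite ffunE (bigD1 (sgval h)) //= big1 ?addr0 => [|l /negPf hl].
    by rewrite ffunE eqxx mul1r.
  by rewrite ffunE hl mul0r.
exists e => a; apply/ffunP => g; rewrite sum_ffunE.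
have reprP : (g * (repr (H :* g))^-1)%g \in H.
  by case: repr_rcosetP => h hH; rewrite invMg mulKVg groupV.
rewrite (bigD1 (subg H (g * (repr (H :* g))^-1)%g)) //= big1 => [|h].
  rewrite addr0 actE subgK //= ffunE actE /= subgK // invMg invgK mulgKV.
  by rewrite rcoset_repr eqxx invMg !invgK -mulgA mulVg mulg1.
rewrite actE ffunE actE /= invgK mulKVg => /eqP neq_h.
rewrite rcosetM rcoset_id ?groupV ?subgP // ifN //; apply/eqP => gE.
by case: neq_h; apply: val_inj; rewrite /= subgK // -gE invMg invgK mulKVg.
Qed.

End Cochains.

(** * Ideals and their index *)

Section LocalRing.
Variable L : comNzRingType.

(** Units of a ring without a chosen inverse operation. *)
Definition invertible (a : L) := exists b, b * a = 1.

Lemma invertibleM a b : invertible a -> invertible b -> invertible (a * b).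
Proof.
move=> [a' a'a] [b' b'b]; exists (a' * b').
by rewrite mulrACA a'a b'b mulr1.
Qed.

Lemma invertible_factor a b : invertible (a * b) -> invertible a.
Proof. by move=> [c cab]; exists (c * b); rewrite -mulrA [b * a]mulrC. Qed.

Lemma invertible_cancel u a : invertible u -> u * a = 0 -> a = 0.
Proof. by move=> [v vu] ua0; rewrite -[a]mul1r -vu -mulrA ua0 mulr0. Qed.

Record is_ideal (I : set L) : Prop := IsIdeal {
  ideal0 : I 0;
  idealD : forall a b, I a -> I b -> I (a + b);
  idealM : forall r a, I a -> I (r * a)
}.

Definition adjoin (I : set L) (y : L) : set L :=
  [set a | exists x b, I x /\ a = x + b * y].

Section Ideals.
Variable I : set L.
Hypothesis idI : is_ideal I.

Lemma idealN a : I a -> I (- a).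
Proof. by rewrite -mulN1r; apply: idealM. Qed.

Lemma idealB a b : I a -> I b -> I (a - b).
Proof. by move=> Ia /idealN; apply: idealD. Qed.

Lemma ideal_invertible u a : invertible u -> I (u * a) -> I a.
Proof. by move=> [v vu] /(idealM idI v); rewrite mulrA vu mul1r. Qed.

Lemma adjoin_ideal y : is_ideal (adjoin I y).
Proof.
split=> [|a b [x [s [Ix ->]]] [x' [s' [Ix' ->]]]|r a [x [s [Ix ->]]]].
- by exists 0, 0; rewrite mul0r addr0; split=> //; apply: ideal0.
- exists (x + x'), (s + s'); rewrite mulrDl addrACA.
  by split=> //; apply: idealD.
- by exists (r * x), (r * s); rewrite mulrDr mulrA; split=> //; apply: idealM.
Qed.

Lemma sub_adjoin y : I `<=` adjoin I y.
Proof. by move=> x Ix; exists x, 0; rewrite mul0r addr0. Qed.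

Lemma mem_adjoin y : adjoin I y y.
Proof. by exists 0, 1; rewrite mul1r add0r; split=> //; apply: ideal0. Qed.

Lemma adjoin_sub J y : is_ideal J -> I `<=` J -> J y -> adjoin I y `<=` J.
Proof.
by move=> idJ IJ Jy _ [x [b [/IJ Jx ->]]]; apply: idealD => //; apply: idealM.
Qed.

Lemma adjoin_id y : I y -> adjoin I y = I.
Proof.
by move=> Iy; apply/seteqP; split; [apply: adjoin_sub|apply: sub_adjoin].
Qed.

Lemma adjoin1 : adjoin I 1 = setT.
Proof.
apply/seteqP; split=> // a _; exists 0, a; rewrite mulr1 add0r.
by split=> //; apply: ideal0.
Qed.

End Ideals.

Lemma adjoin_absorb I r y : is_ideal I ->
  adjoin (adjoin I (r * y)) y = adjoin I y.
Proof.
move=> idI; have idIy := adjoin_ideal idI; apply/seteqP; split.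
  apply: adjoin_sub => //; last exact: mem_adjoin.
  apply: adjoin_sub => //; first exact: sub_adjoin.
  by apply: idealM => //; apply: mem_adjoin.
apply: adjoin_sub => //; first by apply: adjoin_ideal.
  by move=> a Ia; apply/sub_adjoin/sub_adjoin.
by apply: mem_adjoin.
Qed.

(** The quotient by I has k elements, expressed by a complete irredundant
family of representatives so that no quotient has to be formed. *)
Definition has_index (I : set L) (k : nat) :=
  exists (T : finType) (r : T -> L),
    #|T| = k /\ forall a, exists! t, I (a - r t).

Lemma has_indexT : has_index setT 1.
Proof.
exists unit, (fun=> 0); rewrite card_unit; split=> // a.
by exists tt; split=> // -[].
Qed.

End LocalRing.

(** * The ideals of finite index *)

Definition least (P : nat -> Prop) (k : nat) :=
  P k /\ forall l, (l < k)%N -> ~ P l.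

Lemma least_exists (P : nat -> Prop) k : P k -> exists l, least P l.
Proof.
move=> Pk; have exP : exists k, `[< P k >] by exists k; apply/asboolP.
case: (ex_minnP exP) => l /asboolP Pl minl; exists l; split=> // m ltml /asboolP.
by move=> /minl; rewrite leqNgt ltml.
Qed.

Lemma least_unique P k l : least P k -> least P l -> k = l.
Proof.
move=> [Pk mink] [Pl minl]; case: (ltngtP k l) => // lt.
  by case: (minl _ lt).
by case: (mink _ lt).
Qed.

(** All that the classification of ideals uses about the group ring of a cyclic
group of order p over the p-adic integers, with D = s - 1 for a generator s, and N
the sum of the group elements. The annihilators of D and N are N L and D L; together D
and N generate the maximal ideal, whose residue field has p elements; the
last two conditions make the ring local. *)
Record p_cyclic_ring (p : nat) (L : comNzRingType) (D N : L) : Prop :=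
  PCyclicRing {
    pcr_prime : prime p;
    pcr_DN : D * N = 0;
    pcr_NE : exists w, N = p%:R + D * w;
    pcr_residue : forall a, exists c b b',
      (c < p)%N /\ a = c%:R + (D * b + N * b');
    pcr_annN : forall a, N * a = 0 -> exists b, a = D * b;
    pcr_annD : forall a, D * a = 0 -> exists b, a = N * b;
    pcr_p_reg : forall a : L, p%:R * a = 0 -> a = 0;
    pcr_N0 : N <> 0;
    pcr_Dp : exists z, D ^+ p = p%:R * z;
    pcr_inv : forall z : L, invertible (1 - p%:R * z)
  }.

Section PCyclicRing.
Variables (p : nat) (L : comNzRingType) (D N : L).
Hypothesis HL : p_cyclic_ring p D N.

Let p_gt0 : (0 < p)%N. Proof. exact: prime_gt0 (pcr_prime HL). Qed.
Let DN0 := pcr_DN HL.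

(** The maximal ideal (D, N). *)
Definition rad (a : L) := exists b b', a = D * b + N * b'.

Lemma norm_sq : N * N = p%:R * N.
Proof. by have [w Nw] := pcr_NE HL; rewrite {1}Nw mulrDl mulrAC DN0 mul0r addr0. Qed.

Lemma N_rad b b' : N * (D * b + N * b') = p%:R * N * b'.
Proof. by rewrite mulrDr !mulrA [N * D]mulrC DN0 mul0r add0r norm_sq. Qed.

(** Since D N = 0, the p-th power of D b + N b' is the sum of the p-th powers,
and both D ^ p and N ^ 2 = p N are divisible by p. *)
Lemma rad_pow x : rad x -> exists z, x ^+ p = p%:R * z.
Proof.
move=> [b [b' ->]]; have [z Dz] := pcr_Dp HL.
set X := D * b; set Y := N * b'.
have XY0 : X * Y = 0 by rewrite mulrACA DN0 mul0r.
have powD k : (X + Y) ^+ k.+1 = X ^+ k.+1 + Y ^+ k.+1.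
  elim: k => // k IHk; rewrite exprS IHk mulrDl !mulrDr -!exprS.
  have -> : X * Y ^+ k.+1 = 0 by rewrite exprS mulrA XY0 mul0r.
  have -> : Y * X ^+ k.+1 = 0 by rewrite exprS mulrA [Y * X]mulrC XY0 mul0r.
  by rewrite addr0 add0r.
have := powD p.-1; rewrite prednK // => ->.
exists (z * b ^+ p + N * b' * b' * (N * b') ^+ p.-2).
rewrite exprMn Dz mulrDr mulrA; congr (_ + _).
rewrite -[X in _ ^+ X](ltn_predK (prime_gt1 (pcr_prime HL))).
have p1_gt0 : (0 < p.-1)%N by rewrite -ltnS prednK // prime_gt1 ?(pcr_prime HL).
rewrite -[X in _ ^+ X.+1](prednK p1_gt0) !exprS !mulrA; congr (_ * _).
by rewrite -norm_sq -!mulrA; congr (_ * _); rewrite mulrCA.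
Qed.

Lemma rad_p : rad p%:R.
Proof.
by have [w Nw] := pcr_NE HL; exists (- w), 1; rewrite mulr1 mulrN Nw addrCA addNr addr0.
Qed.

Lemma rad_D : rad D.
Proof. by exists 1, 0; rewrite mulr1 mulr0 addr0. Qed.

Lemma radM r x : rad x -> rad (r * x).
Proof.
by move=> [b [b' ->]]; exists (r * b), (r * b'); rewrite mulrDr ![r * (_ * _)]mulrCA.
Qed.

(** 1 - x divides 1 - x ^ p, and x ^ p is a multiple of p. *)
Lemma inv_1B x : rad x -> invertible (1 - x).
Proof.
move=> /rad_pow[z xz]; apply: (@invertible_factor _ _ (\sum_(i < p) x ^+ i)).
by rewrite -opprB mulNr -subrX1 opprB xz; apply: pcr_inv HL z.
Qed.

Lemma inv_nat c : (0 < c < p)%N -> invertible (c%:R : L).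
Proof.
move=> /andP[c0 cp]; apply: (@invertible_factor _ _ (egcdn c p).1%:R).
have [u v uv _] := egcdnP p c0.
rewrite /= -natrM mulnC uv.
have /eqP -> : coprime c p.
  by rewrite coprime_sym prime_coprime ?(pcr_prime HL) // gtnNdvd.
by rewrite natrD natrM mulrC -[_ * _]opprK -mulrN addrC; apply: pcr_inv HL _.
Qed.

Lemma inv_natD c x : (0 < c < p)%N -> rad x -> invertible (c%:R + x).
Proof.
move=> cp mx; have ic := inv_nat cp; have [c' c'c] := ic.
have -> : c%:R + x = c%:R * (1 - (- c' * x)).
  by rewrite mulrBr mulr1 mulrA mulrN [_ * c']mulrC c'c mulN1r opprK.
by apply: invertibleM => //; apply/inv_1B/radM.
Qed.

Lemma rad_or_inv a : rad a \/ invertible a.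
Proof.
have [c [b [b' [cp ->]]]] := pcr_residue HL a.
have mx : rad (D * b + N * b') by exists b, b'.
case: (posnP c) => [->|c0]; first by left; rewrite add0r.
by right; apply: inv_natD => //; rewrite c0.
Qed.

Lemma rad_mul_fixed u a : rad u -> a = u * a -> a = 0.
Proof.
move=> /inv_1B iu ua; apply: (invertible_cancel iu).
by rewrite mulrBl mul1r -ua subrr.
Qed.

(** If J is enlarged by an element y outside J that the maximal ideal multiplies
into J, the quotient is a line over the residue field: the multiples c y with c < p
represent it. *)
Lemma has_index_step (J : set L) y k : is_ideal J -> ~ J y ->
  (forall x, rad x -> J (x * y)) ->
  has_index (adjoin J y) k -> has_index J (k * p).
Proof.
move=> idJ nJy mJ [T [r [cardT rP]]].
exists (T * 'I_p)%type, (fun u : T * 'I_p => r u.1 + u.2%:R * y).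
rewrite card_prod card_ord cardT; split=> // a.
have [t [[x [b [Jx ab]]] t_uniq]] := rP a.
have [c [d [d' [cp bE]]]] := pcr_residue HL b.
exists (t, Ordinal cp); split=> /= [|[t' c'] /= Jt'].
  rewrite opprD addrA ab bE mulrDl addrA addrAC addrK.
  by apply: idealD => //; apply: mJ; exists d, d'.
have Jt : J (a - (r t + c%:R * y)).
  rewrite opprD addrA ab bE mulrDl addrA addrAC addrK.
  by apply: idealD => //; apply: mJ; exists d, d'.
have tt' : t = t'.
  apply: t_uniq; exists (a - (r t' + c'%:R * y)), c'%:R; split=> //.
  by rewrite opprD addrA subrK.
subst t'; congr pair; apply/val_inj => /=.
have {Jt Jt'} Jcc' : J ((c%:R - c'%:R) * y).
  have := idealB idJ Jt' Jt; rewrite !opprD !addrA !opprK => /=.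
  by congr (J _); ring.
case: (ltngtP c c') => // lt; case: nJy.
- have: J ((c' - c)%:R * y).
    by rewrite natrB 1?ltnW // -opprB mulNr; apply: idealN.
  apply: ideal_invertible => //; apply: inv_nat.
  by rewrite subn_gt0 lt (leq_ltn_trans (leq_subr _ _)).
- have: J ((c - c')%:R * y) by rewrite natrB 1?ltnW.
  apply: ideal_invertible => //; apply: inv_nat.
  by rewrite subn_gt0 lt (leq_ltn_trans (leq_subr _ _)).
Qed.

(** Successive powers w ^ k y, w in the maximal ideal, multiply the index by p at
each step as long as they stay outside A: if w ^ k y = x + b w ^ (k+1) y with x in
A, then (1 - b w) w ^ k y is in A, and 1 - b w is a unit. *)
Lemma has_index_chain (A : set L) y w n q : is_ideal A ->
  (forall x k, rad x -> adjoin A (w ^+ k.+1 * y) (x * (w ^+ k * y))) ->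
  rad w -> (forall k, (k < n)%N -> ~ A (w ^+ k * y)) ->
  has_index (adjoin A y) q -> has_index (adjoin A (w ^+ n * y)) (q * p ^ n).
Proof.
move=> idA mA mw + idxA; elim: n => [|n IHn] nA.
  by rewrite expr0 mul1r expn0 muln1.
rewrite expnSr mulnA; apply: (@has_index_step _ (w ^+ n * y)).
- exact: adjoin_ideal.
- move=> [x [b [Ax wE]]]; case: (nA n) => //.
  suff: A ((1 - b * w) * (w ^+ n * y)).
    by apply: ideal_invertible => //; apply/inv_1B/radM.
  by rewrite mulrBl mul1r {1}wE exprS -!mulrA addrK.
- by move=> x mx; apply: mA.
- rewrite exprS -mulrA adjoin_absorb //; apply: IHn => k lekn.
  by apply: nA; apply: ltnW.
Qed.

(** The ideal I is measured by its intersection with N L, which p ^ i N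
generates, and by its image in L / N L, which the class of D ^ j generates. *)
Definition invariants (I : set L) (i j : nat) :=
  least (fun k => I (p%:R ^+ k * N)) i /\ least (fun k => adjoin I N (D ^+ k)) j.

(** Descend from L to I + N L through the powers of D, then from I + N L to I
through the multiples p ^ k N. *)
Lemma has_index_invariants I i j : is_ideal I ->
  invariants I i j -> has_index I (p ^ (i + j)).
Proof.
move=> idI [[Ii nIi] [Aj nAj]].
have idA := adjoin_ideal idI N.
have idxA : has_index (adjoin I N) (p ^ j).
  rewrite -(adjoin_id idA Aj) -[D ^+ j]mulr1 -[X in has_index _ X]mul1n.
  apply: has_index_chain => //.
  - move=> _ k [b [b' ->]]; exists (b' * D ^+ k * N), b.
    split; first by apply: idealM => //; apply: mem_adjoin.
    by rewrite exprS; ring.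
  - exact: rad_D.
  - by move=> k kj; rewrite mulr1; apply: nAj.
  - by rewrite adjoin1 //; apply: has_indexT.
rewrite -(adjoin_id idI Ii) addnC expnD; apply: has_index_chain => //.
- move=> _ k [b [b' ->]]; exists 0, b'; split; first exact: ideal0.
  by rewrite mulrC -mulrA N_rad exprS; ring.
- exact: rad_p.
Qed.

Lemma invariants_unique I i j i' j' :
  invariants I i j -> invariants I i' j' -> i = i' /\ j = j'.
Proof.
move=> [a b] [c d]; split; first exact: least_unique a c.
exact: least_unique b d.
Qed.

(** For c in the maximal ideal, N c is p N b' for some b', so factors p can be
split off from N b until the cofactor is a unit. *)
Lemma norm_valuation n b : (exists c, N * b = p%:R ^+ n * N * c) \/
  exists k u, [/\ (k < n)%N, invertible u & N * b = p%:R ^+ k * N * u].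
Proof.
elim: n => [|n [[c Nb]|[k [u [kn iu Nb]]]]].
- by left; exists b; rewrite expr0 mul1r.
- have [[d [d' cE]]|ic] := rad_or_inv c; last by right; exists n, c.
  by left; exists d'; rewrite Nb cE -mulrA N_rad exprSr !mulrA.
- by right; exists k, u; rewrite ltnS ltnW.
Qed.

(** Modulo N, the element D generates the maximal ideal, so factors D can be
split off until the cofactor is a unit. *)
Lemma aug_valuation n a : (exists s b, a = D ^+ n * s + N * b) \/
  exists k u b, [/\ (k < n)%N, invertible u & a = D ^+ k * u + N * b].
Proof.
elim: n => [|n [[s [b aE]]|[k [u [b [kn iu aE]]]]]].
- by left; exists a, 0; rewrite expr0 mul1r mulr0 addr0.
- have [[d [d' sE]]|iu] := rad_or_inv s; last by right; exists n, s, b.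
  left; exists d, (D ^+ n * d' + b); rewrite aE sE exprSr; ring.
- by right; exists k, u, b; rewrite ltnS ltnW.
Qed.

Lemma p_pow_reg n (a : L) : p%:R ^+ n * a = 0 -> a = 0.
Proof.
elim: n => [|n IHn]; first by rewrite expr0 mul1r.
by rewrite exprS -mulrA => /(pcr_p_reg HL)/IHn.
Qed.

Lemma norm_aug_pow j : (0 < j)%N -> N * D ^+ j = 0.
Proof. by case: j => // j _; rewrite exprS mulrA [N * D]mulrC DN0 mul0r. Qed.

(** Multiplication by N kills D ^ j a, and is multiplication by p on N L. *)
Lemma D_pow_N j a b : (0 < j)%N -> D ^+ j * a = N * b -> D ^+ j * a = 0.
Proof.
move=> j0 DE; rewrite DE; apply: (pcr_p_reg HL).
by rewrite mulrA -norm_sq -mulrA -DE mulrA norm_aug_pow // mul0r.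
Qed.

Lemma D_pow_ann j a : D ^+ j * a = 0 -> exists b, a = N * b.
Proof.
elim: j a => [|j IHj] a.
  by rewrite expr0 mul1r => ->; exists 0; rewrite mulr0.
rewrite exprS -mulrA => /(pcr_annD HL)[b].
case: j IHj => [|j] IHj DE; last exact/IHj/(D_pow_N _ DE).
by exists b; rewrite -DE expr0 mul1r.
Qed.

Lemma p_pow_N_neq0 n : p%:R ^+ n * N <> 0.
Proof. by move=> /p_pow_reg; apply: pcr_N0 HL. Qed.

(** If D ^ n = 0 then 1 is a multiple b N of N, and N = N (b N) = b p N
forces N = 0. *)
Lemma D_pow_neq0 n : D ^+ n <> 0.
Proof.
rewrite -[D ^+ n]mulr1 => /D_pow_ann[b oneE]; apply: (pcr_N0 HL).
apply: (@rad_mul_fixed (b * p%:R)); first exact/radM/rad_p.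
by rewrite -[LHS]mulr1 {1}oneE mulrA norm_sq; ring.
Qed.

(** The normal forms. The exponent i.-1 is meant for i > 0; for i = 0 the digit c
is 0. *)
Definition std_ideal (i j c : nat) : set L := [set a | exists s t,
  a = s * (D ^+ j + c%:R * p%:R ^+ i.-1 * N) + t * (p%:R ^+ i * N)].

Lemma std_ideal_ideal i j c : is_ideal (std_ideal i j c).
Proof.
split=> [|a b [s [t ->]] [s' [t' ->]]|r a [s [t ->]]].
- by exists 0, 0; rewrite !mul0r addr0.
- by exists (s + s'), (t + t'); ring.
- by exists (r * s), (r * t); ring.
Qed.

(** If j = 0 then I contains an element 1 - b N, a unit. *)
Lemma invariants_j0 I i : is_ideal I -> invariants I i 0 -> i = 0%N /\ I = setT.
Proof.
move=> idI [[_ nIi] [[x [b [Ix /= oneE]]] _]].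
have I1 : I 1.
  apply: (@ideal_invertible _ _ idI (1 - b * N)).
    by apply/inv_1B/radM; exists 0, 1; rewrite mulr0 mulr1 add0r.
  by rewrite mulr1 -[1](expr0 D) oneE addrK.
have IT : I = setT.
  by apply/seteqP; split=> // a _; rewrite -[a]mulr1; apply: idealM.
split=> //; case: i nIi => // i nIi.
by case: (nIi 0%N) => //; rewrite IT.
Qed.

(** Some D ^ j + N b lies in I. Its product with N is p N b, so N b is a
multiple of p ^ (i - 1) N when i > 0, and modulo p ^ i N only a digit c of the
quotient matters. This element and p ^ i N generate I, because they generate its
image in L / N L and its intersection with N L. *)
Lemma ideal_classification I i j : is_ideal I -> invariants I i j -> (0 < j)%N ->
  exists c, [/\ (c < p)%N, i = 0%N -> c = 0%N & I = std_ideal i j c].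
Proof.
move=> idI [[Ii nIi] [[x0 [b0 [Ix0 DE]]] nAj]] j0.
have idA := adjoin_ideal idI N.
have NI b : I (N * b) -> exists c, N * b = p%:R ^+ i * N * c.
  move=> INb; have [//|[k [u [ki iu NbE]]]] := norm_valuation i b.
  case: (nIi k ki); apply: (ideal_invertible idI iu).
  by rewrite mulrC -NbE.
(* The element of I that generates its image modulo N; it remains to reduce its
   component along N. *)
have ID : I (D ^+ j - b0 * N) by rewrite DE addrK.
have [c [cp ci Iy]] : exists c, [/\ (c < p)%N, i = 0%N -> c = 0%N &
    I (D ^+ j + c%:R * p%:R ^+ i.-1 * N)].
  case: i Ii nIi NI => [|i] Ii nIi NI.
    exists 0%N; split=> //; rewrite !mul0r addr0 -[D ^+ j](subrK (b0 * N)).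
    by apply: idealD => //; apply: idealM => //; rewrite -[N]mul1r.
  have [c NbE] : exists c, N * b0 = p%:R ^+ i * N * c.
    have [|c Nc] := NI (- (p%:R * b0)).
      have := idealM idI N ID; rewrite mulrBr norm_aug_pow // sub0r.
      by congr (I _); rewrite [b0 * N]mulrC mulrA norm_sq; ring.
    exists (- c); apply/eqP; rewrite -subr_eq0; apply/eqP/(pcr_p_reg HL).
    apply: oppr_inj; rewrite oppr0 -[RHS](subrr (p%:R ^+ i.+1 * N * c)) -{1}Nc.
    by rewrite exprS; ring.
  have [d [b [b' [dp cE]]]] := pcr_residue HL (- c).
  exists d; split=> //=.
  have -> : D ^+ j + d%:R * p%:R ^+ i * N =
      D ^+ j - b0 * N - b' * (p%:R ^+ i.+1 * N).
    have dE : d%:R = - c - (D * b + N * b') by rewrite cE addrK.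
    rewrite [b0 * N]mulrC NbE dE exprSr.
    have -> : (- c - (D * b + N * b')) * p%:R ^+ i * N =
      - (p%:R ^+ i * N * c) - p%:R ^+ i * (N * (D * b + N * b')) by ring.
    by rewrite N_rad; ring.
  by apply: idealB => //; apply: idealM.
exists c; split=> //; apply/seteqP; split=> [a Ia|_ [s [t ->]]]; last first.
  by apply: idealD => //; apply: idealM.
have [[s [b aE]]|[k [u [b [kj iu aE]]]]] := aug_valuation j a; last first.
  case: (nAj k kj); apply: (ideal_invertible idA iu).
  by exists a, (- b); split=> //; rewrite aE; ring.
have [|d NdE] := NI (b - s * c%:R * p%:R ^+ i.-1).
  have := idealB idI Ia (idealM idI s Iy).
  by congr (I _); rewrite aE; ring.
exists s, d; rewrite aE [d * _]mulrC -NdE; ring.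
Qed.

(** An equation p ^ k N = s (D ^ j + c p ^ (i-1) N) + t p ^ i N puts D ^ j s
in N L, hence s in N L, and then the right side is a multiple of p ^ i N; this is
absurd for k < i. Modulo N, an equation D ^ k = s D ^ j with k < j would make D
nilpotent. *)
Lemma std_ideal_invariants i j c : (0 < j)%N -> (i = 0%N -> c = 0%N) ->
  invariants (std_ideal i j c) i j.
Proof.
move=> j0 ci; have idI := std_ideal_ideal i j c.
have ipow : c%:R * (p%:R ^+ i.-1 * p%:R) = c%:R * p%:R ^+ i :> L.
  by case: i ci {idI} => [->|i _] //=; rewrite ?mul0r // exprSr.
split; split.
- by exists 0, 1; rewrite mul0r mul1r add0r.
- move=> k ki [s [t kE]].
  have DsE : D ^+ j * s =
      N * (p%:R ^+ k - s * c%:R * p%:R ^+ i.-1 - t * p%:R ^+ i).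
    by rewrite mulrBr mulrBr [N * p%:R ^+ k]mulrC kE; ring.
  have [b sE] := D_pow_ann (D_pow_N j0 DsE).
  apply: (@p_pow_N_neq0 k).
  apply: (@rad_mul_fixed ((b * c%:R + t) * p%:R ^+ (i - k))).
    rewrite -(prednK (_ : 0 < i - k)%N) ?subn_gt0 // exprSr mulrA.
    exact/radM/rad_p.
  rewrite -!mulrA [_ * (_ * N)]mulrA -exprD subnK 1?ltnW // kE sE.
  have -> : N * b * (D ^+ j + c%:R * p%:R ^+ i.-1 * N) =
      b * (N * D ^+ j) + c%:R * p%:R ^+ i.-1 * b * (N * N) by ring.
  rewrite norm_aug_pow // norm_sq mulr0 add0r [RHS]mulrDl; congr (_ + _).
  transitivity (b * (c%:R * (p%:R ^+ i.-1 * p%:R)) * N); first by ring.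
  by rewrite ipow; ring.
- exists (D ^+ j + c%:R * p%:R ^+ i.-1 * N), (- (c%:R * p%:R ^+ i.-1)).
  by split; [exists 1, 0; rewrite mul1r mul0r addr0|ring].
- move=> k kj [_ [b [[s [t ->]] kE]]].
  apply: (@D_pow_neq0 k.+1).
  apply: (@rad_mul_fixed (s * D ^+ (j - k))).
    rewrite -(prednK (_ : 0 < j - k)%N) ?subn_gt0 // exprSr mulrA.
    exact/radM/rad_D.
  rewrite exprS mulrCA -mulrA -exprD subnK 1?ltnW // {1}kE.
  have -> : D * (s * (D ^+ j + c%:R * p%:R ^+ i.-1 * N) + t * (p%:R ^+ i * N) +
      b * N) = s * (D * D ^+ j) +
      (s * c%:R * p%:R ^+ i.-1 + t * p%:R ^+ i + b) * (D * N) by ring.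
  by rewrite DN0 mulr0 addr0 mulrCA.
Qed.

(** Two different digits would put (c - c') p ^ (i-1) N in the ideal, although
c - c' is a unit. *)
Lemma std_ideal_inj i j c c' : (0 < i)%N -> (0 < j)%N -> (c < p)%N -> (c' < p)%N ->
  std_ideal i j c = std_ideal i j c' -> c = c'.
Proof.
move=> i0 j0; wlog lt : c c' / (c' < c)%N => [IH cp cp' E|cp cp' E].
  by case: (ltngtP c c') => // lt; [symmetry|]; apply: IH.
have idI := std_ideal_ideal i j c.
have [|[_ nI] _] := @std_ideal_invariants i j c j0; first by case: (i) i0.
case: (nI i.-1); first by rewrite prednK.
apply: (@ideal_invertible _ _ idI (c - c')%:R).
  by apply: inv_nat; rewrite subn_gt0 lt (leq_ltn_trans (leq_subr _ _)).
rewrite natrB 1?ltnW //.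
have Iy : std_ideal i j c (D ^+ j + c%:R * p%:R ^+ i.-1 * N).
  by exists 1, 0; ring.
have Iy' : std_ideal i j c (D ^+ j + c'%:R * p%:R ^+ i.-1 * N).
  by rewrite E; exists 1, 0; ring.
by have := idealB idI Iy Iy'; congr (std_ideal _ _ _ _); ring.
Qed.

(** If c is a unit, multiplying y = D ^ j + c p ^ (i-1) N by N gives
c p ^ i N, so y generates the second generator as well. It is regular: a y = 0 puts
D ^ j a, hence a, in N L, on which y acts as multiplication by c p ^ i. *)
Lemma std_ideal_principal i j c : (0 < i)%N -> (0 < j)%N -> (0 < c < p)%N ->
  exists y : L, injective (fun b : L => b * y) /\
    forall a, std_ideal i j c a <-> exists b, a = b * y.
Proof.
move=> i0 j0 cp; have [c' c'c] := inv_nat cp.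
set y := D ^+ j + c%:R * p%:R ^+ i.-1 * N.
have Ny : N * y = c%:R * (p%:R ^+ i * N).
  rewrite mulrDr norm_aug_pow // add0r mulrCA norm_sq -[in RHS](prednK i0) exprSr; ring.
exists y; split=> [a b /= abE|a].
  apply/eqP; rewrite -subr_eq0; apply/eqP; move: (a - b) (mulrBl y a b).
  rewrite abE subrr => {abE b} {}a ay0.
  have DaE : D ^+ j * a = N * (- (c%:R * p%:R ^+ i.-1 * a)).
    by apply/eqP; rewrite -subr_eq0 -ay0; apply/eqP; rewrite /y; ring.
  have [b aE] := D_pow_ann (D_pow_N j0 DaE).
  rewrite aE; apply: (@p_pow_reg i); apply: (invertible_cancel (inv_nat cp)).
  transitivity (b * (N * y)); first by rewrite Ny; ring.
  by rewrite mulrA [b * N]mulrC -aE.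
split=> [[s [t ->]]|[b ->]]; last by exists b, 0; rewrite mul0r addr0.
exists (s + t * c' * N); rewrite mulrDl; congr (_ + _).
transitivity (t * (c' * c%:R) * (p%:R ^+ i * N)); first by rewrite c'c; ring.
by rewrite -[RHS]mulrA Ny; ring.
Qed.

End PCyclicRing.

(** * The p-adic integers *)

Section PadicLemmas.
Variable p : nat.
Hypothesis p_prime : prime p.

Let pX_gt1 n : (1 < p ^ n.+1)%N.
Proof. by rewrite -[1%N](exp1n n.+1) ltn_exp2r // prime_gt1. Qed.

Lemma ZpX_eq0 n k : (k%:R == 0 :> 'Z_(p ^ n.+1)) = (p ^ n.+1 %| k)%N.
Proof.
by rewrite -(inj_eq val_inj) /= Zp_nat /= Zp_cast // /dvdn.
Qed.

Lemma ZpX_natP n (x : 'Z_(p ^ n.+1)) : x = (x : nat)%:R.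
Proof. by rewrite natr_Zp. Qed.

Lemma padic_natr (k n : nat) : (k%:R : padic p) n = k%:R.
Proof.
elim: k => [|k IHk]; first by [].
by rewrite !mulrS -IHk.
Qed.

Lemma padic_sum (I : finType) (F : I -> padic p) n :
  (\sum_i F i : padic p) n = \sum_i F i n.
Proof. by elim/big_rec2: _ => // i x y _ <-. Qed.

Lemma padic_natX_eq0 n (x : padic p) : (p%:R ^+ n.+1 * x) n = 0.
Proof.
rewrite -natrX -[LHS]/((_%:R : padic p) n * x n) padic_natr.
by apply/eqP; rewrite [X in X * _](_ : _ = 0) ?mul0r //; apply/eqP; rewrite ZpX_eq0.
Qed.

Lemma padic_val (x : padic p) n :
  (x n : nat) = ((x n.+1 : nat) %% p ^ n.+1)%N.
Proof. by rewrite {1}(padicP x n) val_Zp_nat. Qed.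

Lemma padic_p_reg (x : padic p) : p%:R * x = 0 -> x = 0.
Proof.
move=> px0; apply: padic_eqP => n; rewrite (padicP x n); apply/eqP.
have /eqP : (p%:R * x) n.+1 = 0 by rewrite px0.
rewrite -[(p%:R * x) n.+1]/((p%:R : padic p) n.+1 * x n.+1) padic_natr.
rewrite [X in _ * X]ZpX_natP -natrM !ZpX_eq0.
by move: (nat_of_ord _) => k; rewrite expnS dvdn_pmul2l ?prime_gt0.
Qed.

(** The digits of x are shifted: the n-th component of the quotient is read off
the next component of x. *)
Lemma padic_div_p (x : padic p) : x 0 = 0 -> exists y, x = p%:R * y.
Proof.
move=> x00; have p_dvd n : (p %| x n)%N.
  elim: n => [|n IHn]; first by rewrite x00.
  by move: IHn; rewrite (padic_val x n) /dvdn modn_dvdm // dvdn_exp.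
pose y n : 'Z_(p ^ n.+1) := (x n.+1 %/ p)%:R.
have yP : `[< padic_compat y >].
  apply/asboolP => n; rewrite /y; apply/esym.
  rewrite val_Zp_nat // -[X in (_ %% X)%N](Zp_cast (pX_gt1 n.+1)) padic_mod.
  rewrite (padic_val x n.+1).
  move: (nat_of_ord (x n.+2)) => k.
  rewrite {1}(divn_eq k (p ^ n.+2)); move: (k %/ _)%N (k %% _)%N => q r.
  rewrite (expnSr p n.+1) mulnA divnMDl ?prime_gt0 // natrD natrM.
  by have /eqP -> : (p ^ n.+1)%:R == 0 :> 'Z_(p ^ n.+1);
    rewrite ?ZpX_eq0 // mulr0 add0r.
exists (Padic yP); apply: padic_eqP => n.
rewrite -[RHS]/((p%:R : padic p) n * y n) padic_natr /y -natrM mulnC divnK //.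
exact: padicP.
Qed.

Lemma padic_residue (x : padic p) : exists c y, (c < p)%N /\ x = c%:R + p%:R * y.
Proof.
have [|y xE] := @padic_div_p (x - (x 0%N : nat)%:R).
  rewrite -[LHS]/(x 0%N - (_%:R : padic p) 0%N) padic_natr natr_Zp.
  exact: subrr.
exists (x 0%N), y; split; last by rewrite -xE addrC subrK.
move: (ltn_ord (x 0%N)); move: (nat_of_ord _) => c.
by rewrite (Zp_cast (pX_gt1 0)) expn1.
Qed.

End PadicLemmas.

(** * The group ring of a cyclic group of prime order *)

(** The binomial coefficients other than the two extreme ones are divisible by
p. *)
Lemma exprD1_prime (p : nat) (A : nzRingType) (x : A) : prime p ->
  exists z, (x + 1) ^+ p = 1 + p%:R * z + x ^+ p.
Proof.
move=> p_prime; exists (\sum_(1 <= i < p) x ^+ i *+ ('C(p, i) %/ p)).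
rewrite exprD1n -(big_mkord xpredT (fun i => x ^+ i *+ 'C(p, i))).
rewrite big_nat_recr // big_ltn; last exact: prime_gt0.
rewrite bin0 binn expr0 !mulr1n.
congr (_ + _ + _); rewrite mulr_sumr; apply: eq_big_nat => i ip.
by rewrite mulr_natl -mulrnA divnK // prime_dvd_bin.
Qed.

Section GroupRingLemmas.
Variables (R : comNzRingType) (gT : finGroupType).
Local Notation RG := (group_ring R gT).
Local Notation elt := (@gring_elt R gT).

Lemma gring_mulE (a b : RG) g : (a * b) g = \sum_h a h * b (h^-1 * g)%g.
Proof. by rewrite [LHS]ffunE. Qed.

Lemma gring_elt_mull (h : gT) (a : RG) g : (elt h * a) g = a (h^-1 * g)%g.
Proof.
rewrite gring_mulE (bigD1 h) //= big1 => [|k /negPf kh].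
  by rewrite ffunE eqxx mul1r addr0.
by rewrite ffunE kh mul0r.
Qed.

Lemma gring_eltM g h : elt g * elt h = elt (g * h)%g.
Proof.
by apply/ffunP => x; rewrite gring_elt_mull !ffunE -(inj_eq (mulgI g)) mulKVg.
Qed.

Lemma gring_eltX g n : elt g ^+ n = elt (g ^+ n)%g.
Proof. by elim: n => // n IHn; rewrite exprS IHn gring_eltM expgS. Qed.

(** The embedding of the scalars, as multiples of the neutral element. *)
Definition gring_const (x : R) : RG := [ffun g => if g == 1%g then x else 0].

Lemma gring_constE x h g : (gring_const x * elt h) g = if g == h then x else 0.
Proof.
rewrite gring_mulE (bigD1 1%g) //= big1 => [|k /negPf k1].
  by rewrite !ffunE eqxx invg1 mul1g addr0; case: eqP; rewrite ?mulr1 ?mulr0.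
by rewrite ffunE k1 mul0r.
Qed.

Lemma gring_expand (a : RG) : a = \sum_g gring_const (a g) * elt g.
Proof.
apply/ffunP => g; rewrite sum_ffunE (bigD1 g) //= gring_constE eqxx.
rewrite big1 ?addr0 // => h /negPf hg.
by rewrite gring_constE eq_sym hg.
Qed.

Lemma gring_natl (k : nat) (a : RG) g : (k%:R * a) g = k%:R * a g.
Proof.
elim: k => [|k IHk]; first by rewrite !mul0r ffunE.
by rewrite !mulrS !mulrDl !mul1r ffunE IHk.
Qed.

Lemma gring_const_sum (I : finType) (F : I -> R) :
  gring_const (\sum_i F i) = \sum_i gring_const (F i).
Proof.
apply/ffunP => g; rewrite sum_ffunE ffunE; case: eqP => g1.
  by apply: eq_bigr => i _; rewrite ffunE g1 eqxx.
by rewrite big1 // => i _; rewrite ffunE; case: eqP g1.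
Qed.

Lemma gring_const_nat (k : nat) : gring_const k%:R = k%:R.
Proof.
apply/ffunP => g; rewrite -[k%:R in RHS]mulr1 gring_natl !ffunE.
by case: eqP; rewrite ?mulr1 ?mulr0.
Qed.

Lemma gring_const_natM (k : nat) x : gring_const (k%:R * x) = k%:R * gring_const x.
Proof.
by apply/ffunP => g; rewrite gring_natl !ffunE; case: eqP; rewrite ?mulr0.
Qed.

Lemma gring_constD x y : gring_const (x + y) = gring_const x + gring_const y.
Proof. by apply/ffunP => g; rewrite !ffunE; case: eqP; rewrite ?addr0. Qed.

Definition gring_norm : RG := \sum_g elt g.

Lemma gring_norm_coef g : gring_norm g = 1.
Proof.
rewrite sum_ffunE (bigD1 g) //= big1 => [|h /negPf hg].
  by rewrite ffunE eqxx addr0.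
by rewrite ffunE eq_sym hg.
Qed.

Lemma gring_norm_mull (a : RG) : gring_norm * a = [ffun=> \sum_h a h].
Proof.
apply/ffunP => g; rewrite gring_mulE ffunE.
rewrite [RHS](reindex_inj (mulIg g)) [RHS](reindex_inj invg_inj) /=.
by apply: eq_bigr => h _; rewrite gring_norm_coef mul1r.
Qed.

Lemma gring_elt_norm g : elt g * gring_norm = gring_norm.
Proof.
rewrite /gring_norm mulr_sumr [RHS](reindex_inj (mulgI g)) /=.
by apply: eq_bigr => h _; rewrite gring_eltM.
Qed.

Lemma gring_mulC : abelian [set: gT]%SET -> commutative (@GRing.mul RG).
Proof.
move=> /centsP gTC a b; apply/ffunP => g; rewrite !gring_mulE.
rewrite (reindex_inj (mulgI g)) (reindex_inj invg_inj) /=.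
apply: eq_bigr => h _; rewrite mulrC; congr (b _ * a _).
  by rewrite invMg invgK -mulgA mulVg mulg1.
by apply: gTC; rewrite inE.
Qed.

(** The same ring as the group ring, with commutativity added to its structure:
modules over one are modules over the other by conversion. *)
Definition group_comring (gTC : abelian [set: gT]%SET) : comNzRingType :=
  HB.pack RG (GRing.PzSemiRing_hasCommutativeMul.Build RG (gring_mulC gTC)).

End GroupRingLemmas.

Section CyclicGroupRing.
Variables (p : nat) (gT : finGroupType) (s : gT).
Hypotheses (p_prime : prime p) (card_gT : #|gT| = p).
Hypothesis gT_gen : [set: gT]%SET = <[s]>%g.
Local Notation RG := (group_ring (padic p) gT).
Local Notation elt := (@gring_elt (padic p) gT).
Local Notation N := (gring_norm (padic p) gT).

Lemma gT_abelian : abelian [set: gT]%SET.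
Proof. by rewrite gT_gen cycle_abelian. Qed.

Let mulC := @gring_mulC (padic p) gT gT_abelian.

Definition gring_aug : RG := elt s - 1.
Local Notation D := gring_aug.

Lemma gT_powers g : exists k, g = (s ^+ k)%g.
Proof. by apply/cycleP; rewrite -gT_gen inE. Qed.

Lemma elt_sub1 g : exists w, elt g - 1 = D * w.
Proof.
by have [k ->] := gT_powers g; rewrite -gring_eltX subrX1; eexists.
Qed.

(** Each g is congruent to 1 modulo D, so a is congruent to the sum of its
coefficients. *)
Lemma gring_aug_const (a : RG) :
  exists w, a = gring_const gT (\sum_g a g) + D * w.
Proof.
have /choice[w wE] := elt_sub1.
exists (\sum_g w g * gring_const gT (a g)).
rewrite {1}(gring_expand a) gring_const_sum mulr_sumr -big_split /=.
apply: eq_bigr => g _; rewrite mulrA -wE -[LHS]mulC mulrBl mul1r.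
by rewrite [RHS]addrC subrK.
Qed.

(** N is congruent to the order of the group modulo D. *)
Lemma gring_norm_p : exists w, N = p%:R + D * w.
Proof.
have /choice[w wE] := elt_sub1; exists (\sum_g w g).
have -> : p%:R = \sum_(g : gT) 1 :> RG.
  by rewrite sumr_const -[X in X%:R](card_gT).
rewrite mulr_sumr -big_split /=.
by apply: eq_bigr => g _; rewrite -wE addrC subrK.
Qed.

Lemma gring_aug_norm : D * N = 0.
Proof. by rewrite mulrBl gring_elt_norm mul1r subrr. Qed.

Lemma gring_residue (a : RG) : exists c b b',
  (c < p)%N /\ a = c%:R + (D * b + N * b').
Proof.
have [w aE] := gring_aug_const a.
have [c [y [cp xE]]] := padic_residue p_prime (\sum_g a g).
have [v NE] := gring_norm_p; exists c, (w - v * gring_const gT y), (gring_const gT y).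
split=> //; rewrite {1}aE xE gring_constD gring_const_nat gring_const_natM -addrA.
congr (_ + _); rewrite NE [in X in _ = _ + X]mulrDl mulrBr -mulrA.
by rewrite [X in _ = _ + X]addrC addrA subrK addrC.
Qed.

Lemma gring_norm_ann (a : RG) : N * a = 0 -> exists b, a = D * b.
Proof.
move=> /ffunP/(_ 1%g); rewrite gring_norm_mull !ffunE => sum0.
have [w aE] := gring_aug_const a; exists w; rewrite aE sum0.
by rewrite -[0]/(0%:R) gring_const_nat add0r.
Qed.

(** An element fixed by the generator has constant coefficients. *)
Lemma gring_aug_ann (a : RG) : D * a = 0 -> exists b, a = N * b.
Proof.
move=> /eqP; rewrite mulrBl mul1r subr_eq0 => /eqP sa.
exists (gring_const gT (a 1%g)); apply/ffunP => g.
rewrite gring_norm_mull ffunE (bigD1 1%g) //= big1 => [|h /negPf h1].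
  rewrite ffunE eqxx addr0; have [k ->] := gT_powers g.
  rewrite -[a in LHS](_ : elt (s ^+ k)%g * a = a).
    by rewrite gring_elt_mull mulVg.
  by elim: k => [|k IHk]; rewrite ?mul1r // expgSr -gring_eltM -mulrA sa.
by rewrite ffunE h1.
Qed.

Lemma gring_p_reg (a : RG) : p%:R * a = 0 -> a = 0.
Proof.
move=> /ffunP pa0; apply/ffunP => g; rewrite [RHS]ffunE.
by apply: padic_p_reg => //; rewrite -gring_natl pa0 ffunE.
Qed.

Lemma gring_norm_neq0 : N <> 0.
Proof.
by move=> /ffunP/(_ 1%g); rewrite gring_norm_coef ffunE => /eqP; rewrite oner_eq0.
Qed.

(** Expand s ^ p = 1 with s = D + 1. *)
Lemma gring_aug_pow : exists z, D ^+ p = p%:R * z.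
Proof.
have sp : (D + 1) ^+ p = 1.
  rewrite subrK gring_eltX -card_gT -cardsT gT_gen.
  by rewrite (expg_order s).
have [z] := exprD1_prime D p_prime; rewrite sp => oneE.
exists (- z); rewrite mulrN; apply/esym/addr0_eq/(addrI 1).
by rewrite addr0 addrA -oneE.
Qed.

Lemma gring_mul_at (a b : RG) g n :
  (a * b) g n = \sum_h a h n * b (h^-1 * g)%g n.
Proof. by rewrite gring_mulE padic_sum. Qed.

Lemma gring_natX_at (a : RG) g n : ((p%:R * a) ^+ n.+1) g n = 0.
Proof.
rewrite exprMn_comm; last exact/commr_sym/commr_nat.
by rewrite -natrX gring_natl natrX padic_natX_eq0.
Qed.

(** The geometric series converges p-adically. Its n-th component is that of the
n-th partial sum, since the later terms vanish modulo p ^ (n+1). *)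
Lemma gring_inv_1B (z : RG) : exists b, b * (1 - p%:R * z) = 1.
Proof.
pose S n : RG := \sum_(k < n.+1) (p%:R * z) ^+ k.
have bP g : `[< padic_compat (fun n => S n g n) >].
  apply/asboolP => n; rewrite -padicP /S [in RHS]big_ord_recr /= ffunE.
  have -> (x y : padic p) : (x + y) n = x n + y n by [].
  by rewrite gring_natX_at addr0.
pose b : RG := [ffun g => Padic (bP g)].
exists b; rewrite mulC; apply/ffunP => g; apply: padic_eqP => n.
transitivity (((1 - p%:R * z) * S n) g n).
  by rewrite !gring_mul_at; apply: eq_bigr => h _; congr (_ * _); rewrite ffunE.
rewrite -opprB mulNr -subrX1 opprB.
have -> (u v : RG) : (u - v) g n = u g n - v g n by rewrite !ffunE.
by rewrite gring_natX_at subr0.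
Qed.

Lemma gring_p_cyclic :
  @p_cyclic_ring p (@group_comring (padic p) gT gT_abelian) D N.
Proof.
split.
- exact: p_prime.
- exact: gring_aug_norm.
- exact: gring_norm_p.
- exact: gring_residue.
- exact: gring_norm_ann.
- exact: gring_aug_ann.
- exact: gring_p_reg.
- exact: gring_norm_neq0.
- exact: gring_aug_pow.
- exact: gring_inv_1B.
Qed.

End CyclicGroupRing.

(** * Cyclic modules and their annihilators *)

Section QuotientModule.
Variables (L : comNzRingType) (I : set L).
Hypothesis idI : is_ideal I.

Definition ideal_pred : {pred L} := fun a => `[< I a >].

Lemma ideal_pred_closed : zmod_closed ideal_pred.
Proof.
split=> [|a b /asboolP Ia /asboolP Ib]; apply/asboolP; first exact: ideal0.
exact: idealB.
Qed.

Definition ideal_zmod : zmodClosed L :=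
  HB.pack ideal_pred (GRing.isZmodClosed.Build L ideal_pred ideal_pred_closed).

Local Notation Q := (Quotient.quot ideal_zmod).
Local Notation pi := (\pi_Q)%qT.

Lemma quot_eq a b : pi a = pi b <-> I (a - b).
Proof.
split=> [/eqP|Iab]; first by rewrite -Quotient.idealrBE => /asboolP.
by apply/eqP; rewrite -Quotient.idealrBE; apply/asboolP.
Qed.

Definition quot_scale (a : L) (x : Q) : Q := pi (a * generic_quotient.repr x).

Lemma quot_scaleE a b : quot_scale a (pi b) = pi (a * b).
Proof.
apply/quot_eq; rewrite -mulrBr; apply: idealM => //.
by apply/quot_eq; rewrite reprK.
Qed.

Lemma quot_ind (P : Q -> Prop) : (forall a, P (pi a)) -> forall x, P x.
Proof. by move=> Ppi x; rewrite -[x]reprK. Qed.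

Lemma quot_add a b : pi a + pi b = pi (a + b).
Proof. by rewrite !piE. Qed.

Lemma quot_eq0 a : pi a = 0 <-> I a.
Proof. by rewrite -{2}[a]subr0 -quot_eq !piE. Qed.

Lemma quot_scaleA a b x :
  quot_scale a (quot_scale b x) = quot_scale (a * b) x.
Proof. by elim/quot_ind: x => c; rewrite !quot_scaleE mulrA. Qed.

Lemma quot_scale1 : left_id 1 quot_scale.
Proof. by elim/quot_ind => c; rewrite quot_scaleE mul1r. Qed.

Lemma quot_scaleDr : right_distributive quot_scale +%R.
Proof.
move=> a; elim/quot_ind => b; elim/quot_ind => c.
by rewrite quot_add !quot_scaleE quot_add mulrDr.
Qed.

Lemma quot_scaleDl x : {morph quot_scale^~ x : a b / a + b}.
Proof.
by elim/quot_ind: x => c a b; rewrite !quot_scaleE quot_add mulrDl.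
Qed.

Definition quot_lmod : lmodType L :=
  HB.pack Q (GRing.Zmodule_isLmodule.Build L Q
    quot_scaleA quot_scale1 quot_scaleDr quot_scaleDl).

Definition quot_proj (a : L) : quot_lmod := pi a.

End QuotientModule.

Section CyclicModules.
Variable L : comNzRingType.
Implicit Types M N : lmodType L.

Definition generates M (v : M) := forall m, exists a : L, m = a *: v.

Definition ann M (v : M) : set L := [set a | a *: v = 0].

Lemma quotient_exists (I : set L) : is_ideal I ->
  exists (M : lmodType L) (v : M), generates v /\ ann v = I.
Proof.
move=> idI; pose v := quot_proj idI 1.
have vE a : a *: v = quot_proj idI a by rewrite [LHS]quot_scaleE mulr1.
exists (quot_lmod idI), v; split.
  by elim/quot_ind => a; exists a; rewrite vE.
apply/seteqP; split=> a; rewrite /ann /= vE; first by move=> /(quot_eq0 idI).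
by move=> Ia; apply/(quot_eq0 idI).
Qed.

Lemma ann_ideal M (v : M) : is_ideal (ann v).
Proof.
split=> [|a b|r a]; rewrite /ann /= ?scale0r ?scalerDl => //.
  by move=> -> ->; rewrite addr0.
by rewrite -scalerA => ->; rewrite scaler0.
Qed.

Lemma annB M (v : M) a b : ann v (a - b) <-> a *: v = b *: v.
Proof.
rewrite /ann /= scalerBl; split=> [/eqP|->]; last by rewrite subrr.
by rewrite subr_eq0 => /eqP.
Qed.

(** Over a commutative ring, a cyclic module is determined by the annihilator of
any generator. *)
Lemma module_iso_ann M N (v : M) (w : N) : generates v -> generates w ->
  module_iso M N <-> ann v = ann w.
Proof.
move=> gv gw; split=> [[f [g fK gK]]|E].
  have [b fv] := gw (f v); have [c gwE] := gv (g w).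
  apply/seteqP; split=> a; rewrite /ann /= => av0.
    by rewrite -[w]gK gwE -linearZ scalerA mulrC -scalerA av0 scaler0 linear0.
  apply: (can_inj fK).
  by rewrite linearZ /= fv scalerA mulrC -scalerA av0 scaler0 linear0.
have /choice[c cE] := gv; have /choice[d dE] := gw.
have vw a b : a *: v = b *: v <-> a *: w = b *: w by rewrite -!annB E.
pose f m := c m *: w.
have f_lin : linear f.
  move=> a x y; rewrite /f scalerA -scalerDl; apply/vw.
  by rewrite scalerDl -scalerA -!cE.
pose fL := GRing.isLinear.Build L M N *:%R f f_lin.
pose f' : {linear M -> N} := HB.pack f fL.
exists f', (fun n => d n *: v) => x /=.
  by rewrite [RHS]cE; apply/vw; rewrite -dE.
by rewrite /f [RHS]dE; apply/vw; rewrite -cE.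
Qed.

Lemma has_index_card M (v : M) k : generates v -> has_index (ann v) k ->
  ([set: M] #= `I_k)%card.
Proof.
move=> gv [T [r [<- rP]]].
have /choice[t tE] m : exists t, m = r t *: v.
  have [a ->] := gv m; have [t [/annB av _]] := rP a.
  by exists t.
have tr u : t (r u *: v) = u.
  have [t0 [_ t0_uniq]] := rP (r u).
  transitivity t0; first by apply/esym/t0_uniq/annB/tE.
  by apply: t0_uniq; rewrite subrr; apply: ideal0 (ann_ideal v).
apply: pcard_eq; suff: set_bij [set: M] `I_#|T| (fun m => enum_rank (t m) : nat).
  by move=> /Pbij[f _]; exact: f.
split=> [m _ /=|m n _ _ /= /ord_inj/enum_rank_inj tmn|l /= ltl].
- exact: ltn_ord.
- by rewrite [m]tE [n]tE tmn.
- by exists (r (enum_val (Ordinal ltl)) *: v) => //; rewrite tr enum_valK.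
Qed.

Lemma ann_invertible M (v : M) u a : invertible u -> ann v (u * a) -> ann v a.
Proof. by move=> iu; apply: ideal_invertible iu; apply: ann_ideal. Qed.

(** Pigeonhole principle. *)
Lemma card_collision M k (u : nat -> M) : ([set: M] #= `I_k)%card ->
  exists i j, (i < j)%N /\ u i = u j.
Proof.
move=> /card_set_bijP[f [fk f_inj _]].
have ltfk i : (f (u i) < k)%N by apply: fk.
pose h (i : 'I_k.+1) := Ordinal (ltfk i).
have: ~~ injectiveb h.
  by apply/negP => /injectiveP /leq_card; rewrite !card_ord ltnn.
case/injectivePn => i [j neq_ij /(congr1 val) /= fij].
have {fij} uij : u i = u j by apply: f_inj; rewrite ?inE.
case: (ltngtP i j) => [lt|lt|/val_inj ij]; first by exists i, j.
  by exists j, i.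
by rewrite ij eqxx in neq_ij.
Qed.

(** Counting isomorphism classes of cyclic modules amounts to counting their
annihilators. *)
Lemma nb_iso_ideals (P : lmodType L -> Prop) (T : finType) (I : T -> set L) :
  (forall t, is_ideal (I t)) -> injective I ->
  (forall t M (v : M), generates v -> ann v = I t -> P M) ->
  (forall M, P M -> exists (v : M) t, generates v /\ ann v = I t) ->
  nb_iso_classes P #|T|.
Proof.
move=> idI I_inj IP PI.
have /choice[M MP] t := quotient_exists (idI t).
exists (fun i => M (enum_val i)); split=> [i|i j ij|N PN].
- by have [v [gv vI]] := MP (enum_val i); apply: IP gv vI.
- have [v [gv vI]] := MP (enum_val i); have [w [gw wI]] := MP (enum_val j).
  apply: enum_val_inj; apply: I_inj; rewrite -vI -wI.
  exact/(module_iso_ann gv gw).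
- have [v [t [gv vI]]] := PI N PN; have [w [gw wI]] := MP t.
  exists (enum_rank t); rewrite enum_rankK.
  by apply/(module_iso_ann gv gw); rewrite vI wI.
Qed.

End CyclicModules.

Lemma ltn_ord_pred n (a : 'I_n.-1) : (a.+1 < n)%N.
Proof. by case: n a => [|n] a; [case: a|rewrite ltnS ltn_ord]. Qed.

(** * Modules of rank one and order a power of p *)

Section RankOne.
Variables (p : nat) (L : comNzRingType) (D N : L).
Hypothesis HL : p_cyclic_ring p D N.
Implicit Types M : lmodType L.

Let p_gt1 : (1 < p)%N. Proof. exact: prime_gt1 (pcr_prime HL). Qed.
Let p_gt0 : (0 < p)%N. Proof. exact: ltnW. Qed.

Local Notation invs := (invariants p D N).
Local Notation std := (std_ideal p D N).

(** In a finite module two of the vectors w ^ l a v coincide, say those of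
exponents i < j; then w ^ i (1 - w ^ (j - i)) a kills v, and the second factor is a
unit. *)
Lemma ann_pow M k (v : M) w a : ([set: M] #= `I_k)%card -> rad D N w ->
  exists l, ann v (w ^+ l * a).
Proof.
move=> cardM mw.
have [i [j [ij vij]]] := card_collision (fun l => (w ^+ l * a) *: v) cardM.
exists i; apply: (@ann_invertible _ _ _ (1 - w ^+ (j - i))).
  apply: (inv_1B HL); rewrite -(prednK (_ : 0 < j - i)%N) ?subn_gt0 // exprSr.
  exact: radM.
by rewrite mulrBl mul1r mulrA -exprD subnK 1?ltnW //; apply/annB.
Qed.

Lemma rank1_invariants n M (v : M) : generates v ->
  ([set: M] #= `I_(p ^ n))%card ->
  exists i j, (i + j)%N = n /\ invs (ann v) i j.
Proof.
move=> gv cardM; have idI := ann_ideal v.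
have [i0 Ii0] := ann_pow v N cardM (rad_p HL).
have [j0 Ij0] := ann_pow v 1 cardM (rad_D D N).
have [i li] := least_exists (P := fun k => ann v (p%:R ^+ k * N)) Ii0.
have [j lj] : exists j, least (fun k => adjoin (ann v) N (D ^+ k)) j.
  by apply: (@least_exists _ j0); apply: sub_adjoin; rewrite -[_ ^+ _]mulr1.
exists i, j; split; last by split.
have /(has_index_card gv) cardM' := has_index_invariants HL idI (conj li lj).
have /card_eq_II := card_eq_trans (card_esym cardM') cardM.
by move=> /eqP; rewrite eqn_exp2l // => /eqP.
Qed.

Lemma card_of_invariants i j M (v : M) : generates v -> invs (ann v) i j ->
  ([set: M] #= `I_(p ^ (i + j)))%card.
Proof. by move=> gv /(has_index_invariants HL (ann_ideal v))/has_index_card; apply. Qed.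

(** The ideals of index p ^ n for n > 0: either i = 0 and j = n, or
0 < i < n, j = n - i, with a digit c. *)
Definition order_ideal n (t : option ('I_n.-1 * 'I_p)) : set L :=
  if t is Some (a, c) then std a.+1 (n - a.+1) c else std 0 n 0.

Lemma order_ideal_ideal n t : is_ideal (@order_ideal n t).
Proof. by case: t => [[a c]|]; apply: std_ideal_ideal. Qed.

Lemma order_ideal_invariants n t : (0 < n)%N ->
  exists i j, [/\ (i + j)%N = n, (0 < j)%N & invs (@order_ideal n t) i j].
Proof.
move=> n0; case: t => [[a c]|] /=; last first.
  by exists 0%N, n; split=> //; apply: std_ideal_invariants.
have an := ltn_ord_pred a.
exists a.+1, (n - a.+1)%N; split; [exact/subnKC/ltnW|by rewrite subn_gt0|].
by apply: (std_ideal_invariants HL) => //; rewrite subn_gt0.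
Qed.

Lemma order_ideal_inj n : (0 < n)%N -> injective (@order_ideal n).
Proof.
move=> n0 t t' E.
have invP (u : option ('I_n.-1 * 'I_p)) : invs (order_ideal u)
    (if u is Some (a, _) then a.+1 else 0)
    (if u is Some (a, _) then n - a.+1 else n)%N.
  case: u => [[a c]|] /=; apply: (std_ideal_invariants HL) => //.
  by rewrite subn_gt0 ltn_ord_pred.
have := invP t'; rewrite -E => /(invariants_unique (invP t))[].
case: t t' E => [[a c]|] [[a' c']|] //= E [/val_inj aa'] _; subst a'.
congr (Some (_, _)); apply: val_inj; apply: (std_ideal_inj HL _ _ _ _ E) => //.
by rewrite subn_gt0 ltn_ord_pred.
Qed.

Lemma order_ideal_surj n I i j : is_ideal I -> invs I i j -> (0 < n)%N ->
  (i + j)%N = n -> exists t, I = @order_ideal n t.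
Proof.
move=> idI inv n0 ijn.
have j0 : (0 < j)%N.
  case: j inv ijn => // /(invariants_j0 HL idI)[-> _] n_0.
  by rewrite -n_0 in n0.
have [c [cp ci ->]] := ideal_classification HL idI inv j0.
case: i inv ijn ci => [|i] inv ijn ci.
  by exists None; rewrite /= ci // -ijn.
have ltin : (i < n.-1)%N by rewrite -ijn addSn /= -[X in (X < _)%N]addn0 ltn_add2l.
by exists (Some (Ordinal ltin, Ordinal cp)); rewrite /= -ijn addKn.
Qed.

End RankOne.

(** * Counting *)

(** The group ring is relatively projective over every subgroup, and M is its
quotient by right multiplication by a regular element. *)
Lemma cyclic_ct (R : nzRingType) (gT : finGroupType)
    (M : lmodType (group_ring R gT)) (v : M) (y : group_ring R gT) :
  (forall m, exists a : group_ring R gT, m = a *: v) ->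
  injective (fun b : group_ring R gT => b * y) ->
  (forall a : group_ring R gT, a *: v = 0 <-> exists b, a = b * y) ->
  cohomologically_trivial M.
Proof.
move=> gv y_inj annv H.
have pi_lin : linear (fun a : (group_ring R gT)^o => a *: v).
  by move=> a b c; rewrite scalerDl scalerA.
have y_lin : linear (fun b : (group_ring R gT)^o => b * y : (group_ring R gT)^o).
  by move=> a b c; rewrite mulrDl -scalerAl.
pose pi : {linear (group_ring R gT)^o -> M} :=
  HB.pack (fun a : (group_ring R gT)^o => a *: v)
    (GRing.isLinear.Build _ _ _ *:%R _ pi_lin).
pose mul_y : {linear (group_ring R gT)^o -> (group_ring R gT)^o} :=
  HB.pack (fun b : (group_ring R gT)^o => b * y : (group_ring R gT)^o)
    (GRing.isLinear.Build _ _ _ *:%R _ y_lin).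
apply: (@tate_vanishes_quotient _ _ H (group_ring R gT)^o M pi mul_y) => //.
exact: group_ring_relatively_projective.
Qed.

Section Counting.
Variables (p : nat) (gT : finGroupType) (s : gT).
Hypotheses (p_prime : prime p) (card_gT : #|gT| = p).
Hypothesis gT_gen : [set: gT]%SET = <[s]>%g.

Local Notation RG := (group_ring (padic p) gT).
Local Notation N := (gring_norm (padic p) gT).
Local Notation D := (gring_aug p s).
Let L : comNzRingType := group_comring (padic p) (gT_abelian gT_gen).
Let HL : @p_cyclic_ring p L D N := gring_p_cyclic p_prime card_gT gT_gen.

Local Notation std := (@std_ideal p L D N).

(** The class of D ^ (j-1) is fixed by G, as D ^ j lies in the annihilator;
were it the class of N a, then D ^ (j-1) would lie in I + N L, where I is the
annihilator, against the minimality of j. So the Tate group of degree 0 does not vanish. *)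
Lemma std_ideal0_not_ct i j (M : lmodType L) (v : M) : (0 < j)%N ->
  generates v -> ann v = std i j 0%N ->
  ~ @cohomologically_trivial (padic p) gT M.
Proof.
move=> j0 gv annv ct.
pose M' : lmodType RG := M.
pose m : M' := (D ^+ j.-1 : RG) *: (v : M').
have sm : gring_elt (padic p) s *: m = m.
  apply/eqP; rewrite -subr_eq0 -{2}[m]scale1r -scalerBl -/(gring_aug p s).
  rewrite scalerA -exprS prednK //; apply/eqP.
  rewrite -[LHS]/((D ^+ j : L) *: v); suff: ann v (D ^+ j : L) by [].
  by rewrite annv; exists 1, 0; rewrite !mul0r !addr0 mul1r.
have gm g : gring_elt (padic p) g *: m = m.
  have [k ->] := gT_powers gT_gen g.
  elim: k => [|k IHk]; first exact: scale1r.
  by rewrite expgSr -gring_eltM -scalerA sm.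
have [|f ef fE] := ct [set: gT]%G (Posz 0) [ffun=> m].
  split=> [h t|]; first by rewrite !ffunE gm.
  by apply/ffunP => t; rewrite !ffunE !big_ord_recl big_ord0 !ffunE
       expr0 scale1r expr1 scaleN1r addr0 subrr.
have [a fa] := gv (f [ffun=> 1%g]).
have mE : m = N *: (f [ffun=> 1%g] : M').
  have /ffunP/(_ [ffun=> 1%g]) := fE; rewrite !ffunE => <-.
  rewrite scaler_suml (reindex (@sgval _ [set: gT]%G)) /=; last first.
    by exists (subg [set: gT]%G) => x _; rewrite ?sgvalK ?subgK ?inE.
  apply: eq_bigr => t _; rewrite -ef; congr (f _).
  by apply/ffunP => k; rewrite !ffunE mulg1.
(* Minimality of j, contradicted by D ^ (j-1) = (D ^ (j-1) - N a) + a N. *)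
have [_ [_ /(_ j.-1)]] := std_ideal_invariants HL (i := i) j0 (fun=> erefl 0%N).
rewrite prednK // => /(_ (leqnn _)); apply.
exists (D ^+ j.-1 - (N : L) * a), a; split; last by rewrite [a * _]mulrC subrK.
rewrite -annv; apply/annB; rewrite -scalerA -fa; exact: mE.
Qed.

Lemma principal_ct (M : lmodType L) (v : M) (y : L) (I : set L) :
  generates v -> ann v = I -> injective (fun b : L => b * y) ->
  (forall a, I a <-> exists b, a = b * y) ->
  @cohomologically_trivial (padic p) gT M.
Proof.
move=> gv annv y_inj IE; apply: (@cyclic_ct (padic p) gT M v y gv y_inj) => a.
by rewrite -IE -annv.
Qed.

Lemma card_ann_setT (M : lmodType L) (v : M) : generates v -> ann v = setT ->
  ([set: M] #= `I_(p ^ 0))%card.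
Proof.
by move=> gv annv; apply: (has_index_card gv); rewrite annv; apply: has_indexT.
Qed.

Lemma rank1_order0 (M : lmodType L) : @rank1_of_order p gT 0 M ->
  exists v : M, generates v /\ ann v = setT.
Proof.
move=> [[v gv] cardM]; exists v; split=> //.
have [i [j [/eqP]]] := rank1_invariants HL gv cardM.
rewrite addn_eq0 => /andP[_ /eqP ->].
by move=> /(invariants_j0 HL (@ann_ideal L M v))[].
Qed.

Lemma rank1_order n (M : lmodType L) : (0 < n)%N -> @rank1_of_order p gT n M ->
  exists (v : M) t, generates v /\ ann v = @order_ideal p L D N n t.
Proof.
move=> n0 [[v gv] cardM]; exists v.
have [i [j [ijn inv]]] := rank1_invariants HL gv cardM.
by have [t ->] := order_ideal_surj HL (@ann_ideal L M v) inv n0 ijn; exists t.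
Qed.

Lemma order_ideal_rank1 n t (M : lmodType L) (v : M) : (0 < n)%N ->
  generates v -> ann v = @order_ideal p L D N n t -> @rank1_of_order p gT n M.
Proof.
move=> n0 gv annv; split; first by exists v.
have [i [j [ijn _]]] := order_ideal_invariants HL t n0; rewrite -annv.
by move=> /(card_of_invariants HL gv); rewrite ijn.
Qed.

Lemma rank1_count n : nb_iso_classes (@rank1_of_order p gT n)
  (if (2 <= n)%N then 1 + p * (n - 1) else 1)%N.
Proof.
case: (posnP n) => [-> | n0].
  rewrite /= -card_unit.
  apply: (@nb_iso_ideals L (@rank1_of_order p gT 0) unit (fun=> setT)) => //.
  - by case=> -[].
  - by move=> _ M v gv /(card_ann_setT gv) cardM; split=> //; exists v.
  - by move=> M /rank1_order0[v gv]; exists v, tt.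
have -> : (if (2 <= n)%N then 1 + p * (n - 1) else 1)%N =
    #|{: option ('I_n.-1 * 'I_p)}|.
  rewrite card_option card_prod !card_ord mulnC add1n -subn1.
  case: ltnP => // n1; have -> : n = 1%N by apply/eqP; rewrite eqn_leq n1.
  by [].
apply: (@nb_iso_ideals L (@rank1_of_order p gT n) _ (@order_ideal p L D N n)).
- exact: order_ideal_ideal.
- exact: (order_ideal_inj HL n0).
- by move=> t M v; apply: order_ideal_rank1.
- by move=> M; apply: rank1_order.
Qed.

Lemma ct_rank1_count n : nb_iso_classes (@ct_rank1_of_order p gT n)
  (if (2 <= n)%N then (p - 1) * (n - 1) else if n == 1%N then 0 else 1)%N.
Proof.
case: (posnP n) => [-> | n0].
  rewrite /= -card_unit.
  apply: (@nb_iso_ideals L (@ct_rank1_of_order p gT 0) unit (fun=> setT)) => //.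
  - by case=> -[].
  - move=> _ M v gv annv; split.
      by split; [exists v|apply: card_ann_setT annv].
    apply: (principal_ct (y := 1) gv annv) => [a b|a]; rewrite ?mulr1 //.
    by split=> // _; exists a; rewrite mulr1.
  - by move=> M [/rank1_order0[v gv] _]; exists v, tt.
have -> : (if (2 <= n)%N then (p - 1) * (n - 1) else if n == 1 then 0 else 1)%N =
    #|{: 'I_n.-1 * 'I_p.-1}|.
  rewrite card_prod !card_ord mulnC -!subn1; case: ltnP => // n1.
  have -> : n = 1%N by apply/eqP; rewrite eqn_leq n1.
  by rewrite subnn mul0n.
pose index (u : 'I_n.-1 * 'I_p.-1) : option ('I_n.-1 * 'I_p) :=
  Some (u.1, Ordinal (ltn_ord_pred u.2)).
apply: (@nb_iso_ideals L (@ct_rank1_of_order p gT n) _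
  (fun u => @order_ideal p L D N n (index u))).
- by move=> u; apply: order_ideal_ideal.
- move=> [a c] [a' c'] /(order_ideal_inj HL n0)[/= -> cc'].
  by congr pair; apply: val_inj.
- move=> [a c] M v gv annv; split; first exact: order_ideal_rank1 gv annv.
  have j0 : (0 < n - a.+1)%N by rewrite subn_gt0 ltn_ord_pred.
  have cp : (0 < c.+1 < p)%N by rewrite ltn_ord_pred.
  have [y [y_inj yE]] := std_ideal_principal HL (i := a.+1) isT j0 cp.
  exact: principal_ct gv annv y_inj yE.
- move=> M [rM ctM]; have [v [t [gv annv]]] := rank1_order n0 rM.
  case: t annv => [[a [[|c] cp]]|] annv.
  + have j0 : (0 < n - a.+1)%N by rewrite subn_gt0 ltn_ord_pred.
    by case: (std_ideal0_not_ct j0 gv annv ctM).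
  + have cp' : (c < p.-1)%N by rewrite -ltnS prednK // prime_gt0.
    by exists v, (a, Ordinal cp').
  + by case: (std_ideal0_not_ct n0 gv annv ctM).
Qed.

End Counting.

(** For n >= 2 the ratio is (1 - 1/p) (1 - 1/(1 + p (n - 1))). *)
Lemma ratio_cvg (R : realType) (p : nat) : (0 < p)%N ->
  (fun n => ((if (2 <= n)%N then (p - 1) * (n - 1)
              else if n == 1 then 0 else 1)%N)%:R /
            ((if (2 <= n)%N then 1 + p * (n - 1) else 1)%N)%:R : R) @ \oo
    --> (1 - p%:R^-1 : R).
Proof.
move=> p0; rewrite -(cvg_shiftn 2) /=.
have pR0 : (p%:R : R) != 0 by rewrite pnatr_eq0 -lt0n.
pose u n : R := ((1 + p * n.+1)%N%:R)^-1.
rewrite [X in X @ _](_ : _ = fun n => (1 - p%:R^-1) * (1 - u n)); last first.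
  apply/funext => n; rewrite addn2 /= (_ : n.+2 - 1 = n.+1)%N; last by rewrite subn1.
  have d0 : (1 + p%:R * n.+1%:R : R) != 0.
    by rewrite -natrM nat1r pnatr_eq0.
  rewrite /u !natrD !natrM natrB //.
  by move: (n.+1%:R : R) d0 => x d0; field; rewrite pR0 d0.
suff u0 : u @ \oo --> (0 : R).
  have := cvgM (cvg_cst (1 - p%:R^-1 : R)) (cvgB (cvg_cst (1 : R)) u0).
  by rewrite subr0 mulr1; apply.
apply: (@squeeze_cvgr _ _ _ _ (fun=> 0) (@harmonic R)).
- apply: nearW => n; rewrite /u invr_ge0 ler0n /= lef_pV2 ?posrE ?ltr0n //.
  by rewrite ler_nat add1n ltnW // ltnS leq_pmull.
- exact: cvg_cst.
- exact: cvg_harmonic.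
Qed.

Theorem mainTheorem3 (p : nat) (gT : finGroupType) (R : realType) :
  prime p -> cyclic [set: gT]%SET -> #|gT| = p ->
  exists b c : nat -> nat,
    [/\ forall n, nb_iso_classes (@rank1_of_order p gT n) (b n),
        forall n, nb_iso_classes (@ct_rank1_of_order p gT n) (c n),
        forall n, b n = (if (2 <= n)%N then 1 + p * (n - 1) else 1)%N,
        forall n, c n = (if (2 <= n)%N then (p - 1) * (n - 1)
                         else if n == 1 then 0 else 1)%N
      & (fun n => (c n)%:R / (b n)%:R : R) @ \oo --> (1 - p%:R^-1 : R)].
Proof.
move=> p_prime /cyclicP[s gT_gen] card_gT.
exists (fun n => if (2 <= n)%N then 1 + p * (n - 1) else 1)%N.
exists (fun n => if (2 <= n)%N then (p - 1) * (n - 1)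
                 else if n == 1%N then 0 else 1)%N.
split=> // [n|n|].
- exact: (rank1_count p_prime card_gT gT_gen).
- exact: (ct_rank1_count p_prime card_gT gT_gen).
- exact/ratio_cvg/prime_gt0.
Qed.
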